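(* Let $\Gamma$ be a group, $A$ a principal ideal domain, $H=H^1(\Gamma;A)$, and let $K_n\le H^{\otimes n}$ be the tensors on which the $n$-th Massey product is defined and vanishes. Let $k\ge1$. For $\varphi\in J^A(k)$, the endomorphism $T\mapsto T-\varphi^*(T)$ of $H^0_{Bar}(\Gamma;A)_{\le k+1}$ determines an $A$-linear map $\tau_\varphi\colon K_{k+1}\to H$, and $\varphi\mapsto\tau_\varphi$ is an $\operatorname{Aut}(\Gamma)$-equivariant group homomorphism $$J^A(k)\to\operatorname{Hom}_A(K_{k+1},H).$$ Furthermore, its kernel always contains $J^A(k+1)$, and is exactly this subgroup whenever $\Gamma$ is finitely generated and $A[\Gamma]/I^{k+2}$ is $A$-torsion free (e.g. when $A$ is a field).
   Context: $A$ is a PID and $\otimes=\otimes_A$. $I\subseteq A[\Gamma]$ is the augmentation ideal. The Johnson filtration modulo $A$ consists of the subgroups $J^A(k)\le\operatorname{Aut}(\Gamma)$, $J^A(k)$ being the pointwise stabilizer of $A[\Gamma]/I^{k+1}$. $\operatorname{Aut}(\Gamma)$ acts on $J^A(k)$ by conjugation $\varphi\mapsto\chi\varphi\chi^{-1}$, and on $\operatorname{Hom}_A(K_{k+1},H)$ by $(\chi\cdot f)(T)=(\chi^{-1})^*f(\chi^*(T))$. Bar construction. For an augmented associative dg $A$-algebra $C^*$ with augmentation ideal $\overline C$, put $Bar(C)=\bigoplus_{p\ge 0}(\overline C[1])^{\otimes p}$. A tensor $(c_1|\cdots|c_p)$ has weight $p$ and degree $\sum_i(|c_i|-1)$. The differential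 is $d_{Bar}=d_1+d_2$ with $d_1(c_1|\cdots|c_p)=-\sum_{i}(-1)^{(i-1)+|c_1|+\dots+|c_{i-1}|}(c_1|\cdots|dc_i|\cdots|c_p)$ and $d_2(c_1|\cdots|c_p)=-\sum_{i<p}(-1)^{i+|c_1|+\dots+|c_i|}(c_1|\cdots|c_ic_{i+1}|\cdots|c_p)$. It is a dg coalgebra under deconcatenation $\Delta(c_1|\cdots|c_p)=\sum_{i=0}^p(c_1|\cdots|c_i)\otimes(c_{i+1}|\cdots|c_p)$, with counit $\eta$ the projection to the weight-$0$ summand $A$ and coaugmentation $1\in A$. $B\Gamma$ is the simplicial bar construction ($B\Gamma_p=\Gamma^p$), $C^*_\cup(B\Gamma;A)$ its algebra of normalized simplicial cochains with cup product, augmented at the basepoint, and $H^0_{Bar}(\Gamma;A):=H^0(Bar(C^*_\cup(B\Gamma;A)))$: a torsion-free module with coalgebra structure induced by $\Delta$ and the Künneth isomorphism, filtered by $H^0_{Bar}(\Gamma;A)_{\le n}=\ker\big(H^0(Bar)\to H^0(Bar/Bar_{\le n})\big)$ where $Bar_{\le n}$ is the part of weight $\le n$. It is contravariantly functorial in $\Gamma$, giving $\varphi^*$ for $\varphi\in\operatorname{Aut}(\Gamma)$. The reduced coproduct is $\overline\Delta(x)=\Delta(x)-x\otimes1-1\otimes x$ on $\ker\eta$ (extended by $\overline{\Delta}(1)=0$), with iterates $\overline\Delta^{n}$. The weight-$\le1$ part of $\ker\eta$ is $H^1(\Gamma;A)=\operatorname{Hom}(\Gamma,A)$. The leading-term map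 $\operatorname{lead}=\overline\Delta^{n-1}\colon H^0_{Bar}(\Gamma;A)_{\le n}\to H^1(\Gamma;A)^{\otimes n}$ (for $n=1$, $T\mapsto T-\eta(T)1$) has kernel $H^0_{Bar}(\Gamma;A)_{\le n-1}$; its image is $K_n$, which consists precisely of those tensors on which all differentials of the weight spectral sequence of $Bar(C^*_\cup(B\Gamma;A))$ (cup and higher Massey products) are defined and vanish. Thus $K_n\cong H^0_{Bar}(\Gamma;A)_{\le n}/H^0_{Bar}(\Gamma;A)_{\le n-1}$. The map $\tau_\varphi$ is determined by $\tau_\varphi(\operatorname{lead}(T))=T-\varphi^*(T)$ for $T\in H^0_{Bar}(\Gamma;A)_{\le k+1}$, the right-hand side lying in $H^1(\Gamma;A)$. *)

(* Defs.v *)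
From HB Require Import structures.
From mathcomp Require Import all_boot all_order all_algebra finmap.
From mathcomp Require Import boolp functions.
From mathcomp.multinomials Require Import monalg.

Set Implicit Arguments.
Unset Strict Implicit.
Unset Printing Implicit Defensive.

Import Order.TTheory GRing.Theory Num.Theory.
Local Open Scope ring_scope.
Local Open Scope quotient_scope.

Definition is_PID (A : idomainType) : Prop :=
  forall J : A -> Prop,
    J 0 -> (forall x y, J x -> J y -> J (x + y)) ->
    (forall a x, J x -> J (a * x)) ->
  exists a, forall x, J x <-> exists b, x = b * a.

Section LinearExtension.
Variables (A : comNzRingType) (K : choiceType) (M : lmodType A).
Implicit Types (F : K -> M) (x : {malg A[K]}).

Definition mlin F x : M := \sum_(k <- msupp x) x@_k *: F k.

Lemma mlinEw F x (D : {fset K}) : (msupp x `<=` D)%fset ->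
  mlin F x = \sum_(k <- D) x@_k *: F k.
Proof.
move=> sD; rewrite /mlin (big_fset_incl _ sD) // => k _ /mcoeff_outdom ->.
by rewrite scale0r.
Qed.

Lemma mlin_is_linear F : linear (mlin F).
Proof.
move=> a x y; set D := (msupp x `|` msupp y)%fset.
have sx : (msupp x `<=` D)%fset by exact: fsubsetUl.
have sy : (msupp y `<=` D)%fset by exact: fsubsetUr.
have sxy : (msupp (a *: x + y) `<=` D)%fset.
  by apply: fsubset_trans (msuppD_le _ _) _; apply: fsetSU (msuppZ_le _ _).
rewrite (mlinEw F sxy) (mlinEw F sx) (mlinEw F sy) scaler_sumr -big_split /=.
by apply: eq_bigr => k _; rewrite mcoeffD mcoeffZ scalerDl scalerA.
Qed.

HB.instance Definition _ F :=
  GRing.isLinear.Build A {malg A[K]} M *:%R (mlin F) (mlin_is_linear F).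

Lemma mlinU F k : mlin F << k >> = F k.
Proof.
by rewrite (mlinEw F msuppU_le) big_seq_fset1 mcoeffUU scale1r.
Qed.

Lemma malg_ext (f g : {linear {malg A[K]} -> M}) :
  (forall k, f << k >> = g << k >>) -> f =1 g.
Proof.
move=> fg x; rewrite [x]monalgE !linear_sum; apply: eq_bigr => k _.
have -> : << x@_k *g k >> = x@_k *: << k >> :> {malg A[K]}.
  by apply/malgP => k'; rewrite mcoeffZ !mcoeffU mulrnAr mulr1.
by rewrite !linearZ fg.
Qed.

End LinearExtension.

Lemma malg_gen (A : comNzRingType) (K : choiceType) (x : {malg A[K]}) :
  x = mlin (fun k => << k >> : {malg A[K]}) x.
Proof.
rewrite -[LHS]/(idfun x); move: x; apply: malg_ext => k /=.
by rewrite mlinU.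
Qed.

(** Finitely supported functions [G -> A] with the convolution product [gmul]. *)
Definition group_ring (A : comNzRingType) (G : groupType) : Type := {malg A[G]}.

Section GroupRing.
Variables (A : comNzRingType) (G : groupType).
Local Notation AG := (group_ring A G).

HB.instance Definition _ := GRing.Lmodule.copy AG {malg A[G]}.

Definition gmul (x y : {malg A[G]}) : {malg A[G]} :=
  mlin (fun g => mlin (fun h => << (g * h)%g >>) y) x.

Definition gone : {malg A[G]} := << 1%g >>.

Lemma gmulU g h : gmul << g >> << h >> = << (g * h)%g >>.
Proof. by rewrite /gmul !mlinU. Qed.

Lemma gmulPl y a x x' : gmul (a *: x + x') y = a *: gmul x y + gmul x' y.
Proof. exact: linearP. Qed.

Lemma gmulPr x a y y' : gmul x (a *: y + y') = a *: gmul x y + gmul x y'.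
Proof.
rewrite /gmul /mlin scaler_sumr -big_split /=; apply: eq_bigr => g _.
rewrite -!/(mlin _ _) linearP scalerDr !scalerA.
by rewrite mulrC.
Qed.

Definition gmulr y x := gmul x y.
HB.instance Definition _ y :=
  GRing.isLinear.Build A {malg A[G]} {malg A[G]} *:%R (gmulr y) (gmulPl y).
HB.instance Definition _ x :=
  GRing.isLinear.Build A {malg A[G]} {malg A[G]} *:%R (gmul x) (gmulPr x).

Lemma gmulA : associative gmul.
Proof.
move=> x y z.
have -> : gmul x (gmul y z) = (gmulr (gmul y z) : {linear _ -> _}) x by [].
have -> : gmul (gmul x y) z = (gmulr z \o gmulr y : {linear _ -> _}) x by [].
apply: malg_ext => g /=; rewrite /gmulr.
have -> : gmul << g >> (gmul y z) = (gmul << g >> \o gmulr z : {linear _ -> _}) y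
  by [].
have -> : gmul (gmul << g >> y) z = (gmulr z \o gmul << g >> : {linear _ -> _}) y
  by [].
apply: malg_ext => h /=; rewrite /gmulr.
have -> : gmul << g >> (gmul << h >> z)
  = (gmul << g >> \o gmul << h >> : {linear _ -> _}) z by [].
apply: malg_ext => l /=.
by rewrite !gmulU mulgA.
Qed.

Lemma gmul1 : left_id gone gmul.
Proof.
move=> x; rewrite -[RHS]/(idfun x); move: x; apply: malg_ext => g /=.
by rewrite gmulU mul1g.
Qed.

Lemma gmulr1 : right_id gone gmul.
Proof.
move=> x; rewrite -[LHS]/(gmulr gone x) -[RHS]/(idfun x); move: x.
by apply: malg_ext => g /=; rewrite /gmulr gmulU mulg1.
Qed.

Lemma gmulDl : left_distributive gmul +%R.
Proof. by move=> x y z; exact: (linearD (gmulr z)). Qed.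

Lemma gmulDr : right_distributive gmul +%R.
Proof. by move=> x y z; exact: (linearD (gmul x)). Qed.

Lemma gone_neq0 : gone != 0.
Proof. by rewrite monalgU_eq0 oner_eq0. Qed.

HB.instance Definition _ := GRing.Zmodule_isNzRing.Build AG
  gmulA gmul1 gmulr1 gmulDl gmulDr gone_neq0.

Definition augmentation (x : AG) : A := mlin (fun _ => 1 : A^o) x.

Definition aug_ideal (x : AG) : Prop := augmentation x = 0.

End GroupRing.

(** [ideal_pow I n] is the additive span of the [n]-fold products of elements
    of the ideal [I]; for [n = 0] it is the whole ring. *)
Fixpoint ideal_pow (R : nzRingType) (I : R -> Prop) (n : nat) (x : R) : Prop :=
  if n is m.+1 then
    exists s : seq (R * R),
      (forall p, p \in s -> I p.1 /\ ideal_pow I m p.2) /\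
      x = \sum_(p <- s) p.1 * p.2
  else True.

Definition quot_torsion_free (A : comNzRingType) (M : lmodType A)
    (N : M -> Prop) : Prop :=
  forall (a : A) (x : M), a != 0 -> N (a *: x) -> N x.

Definition fin_gen (G : groupType) : Prop :=
  exists s : seq G, forall S : groupClosed G, {subset s <= S} -> forall g, g \in S.

(** The product [f * g] is the composite [f \o g]. *)
Record group_aut (G : groupType) : Type := MkAut {
  aut_fun :> G -> G;
  aut_inv : G -> G;
  autM : {morph aut_fun : g h / (g * h)%g >-> (g * h)%g};
  autK : cancel aut_fun aut_inv;
  autVK : cancel aut_inv aut_fun
}.

Section AutGroup.
Variable G : groupType.
Implicit Types f g h : group_aut G.

Lemma aut_ext f g : f =1 g -> f = g.
Proof.
case: f g => f f' fM fK f'K [g g' gM gK g'K] /= /funext fg; subst g.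
have e : f' = g' by apply: funext => x; rewrite -[x]f'K fK gK.
by subst g'; congr MkAut; apply: Prop_irrelevance.
Qed.

HB.instance Definition _ := gen_eqMixin (group_aut G).
HB.instance Definition _ := gen_choiceMixin (group_aut G).

Definition aut_one : group_aut G :=
  @MkAut G id id (fun _ _ => erefl) (fun _ => erefl) (fun _ => erefl).

Lemma aut_mulM f g : {morph f \o g : x y / (x * y)%g >-> (x * y)%g}.
Proof. by move=> x y /=; rewrite !autM. Qed.

Definition aut_mul f g : group_aut G :=
  @MkAut G (f \o g) (aut_inv g \o aut_inv f) (@aut_mulM f g)
    (can_comp (@autK _ f) (@autK _ g)) (can_comp (@autVK _ g) (@autVK _ f)).

Lemma aut_invM f : {morph aut_inv f : x y / (x * y)%g >-> (x * y)%g}.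
Proof. by move=> x y; rewrite -{1}[x](autVK f) -{1}[y](autVK f) -autM autK. Qed.

Definition aut_V f : group_aut G :=
  @MkAut G (aut_inv f) f (@aut_invM f) (@autVK _ f) (@autK _ f).

Lemma aut_mulA : associative aut_mul. Proof. by move=> f g h; apply: aut_ext. Qed.
Lemma aut_mul1 : left_id aut_one aut_mul. Proof. by move=> f; apply: aut_ext. Qed.
Lemma aut_mulr1 : right_id aut_one aut_mul. Proof. by move=> f; apply: aut_ext. Qed.
Lemma aut_mulV : left_inverse aut_one aut_V aut_mul.
Proof. by move=> f; apply: aut_ext => x /=; rewrite autK. Qed.
Lemma aut_mulrV : right_inverse aut_one aut_V aut_mul.
Proof. by move=> f; apply: aut_ext => x /=; rewrite autVK. Qed.

HB.instance Definition _ := isGroup.Build (group_aut G)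
  aut_mulA aut_mul1 aut_mulr1 aut_mulV aut_mulrV.

Lemma aut1E x : (1%g : group_aut G) x = x. Proof. by []. Qed.
Lemma autME f g x : (f * g)%g x = f (g x). Proof. by []. Qed.
Lemma aut1 f : f 1%g = 1%g.
Proof. by apply: (mulIg (f 1%g)); rewrite -autM !mul1g. Qed.

End AutGroup.

Section Johnson.
Variables (A : comNzRingType) (G : groupType).
Local Notation AG := (group_ring A G).
Implicit Types f g : group_aut G.

Definition group_ring_map f (x : AG) : AG :=
  mlin (fun l => << f l >> : {malg A[G]}) x.

Lemma group_ring_map_linear f : linear (group_ring_map f).
Proof. exact: mlin_is_linear. Qed.

HB.instance Definition _ f :=
  GRing.isLinear.Build A AG AG *:%R (group_ring_map f) (group_ring_map_linear f).

Lemma group_ring_mapU f l : group_ring_map f << l >> = << f l >> :> {malg A[G]}.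
Proof. exact: mlinU. Qed.

Lemma group_ring_mapM f x y :
  group_ring_map f (x * y) = group_ring_map f x * group_ring_map f y.
Proof.
have -> : group_ring_map f (x * y) =
  (mlin (fun l => << f l >> : {malg A[G]}) \o gmulr y : {linear _ -> _}) x by [].
have -> : group_ring_map f x * group_ring_map f y =
  (gmulr (group_ring_map f y) \o mlin (fun l => << f l >> : {malg A[G]})
    : {linear _ -> _}) x by [].
apply: malg_ext => g /=; rewrite /gmulr mlinU.
have -> : mlin (fun l => << f l >> : {malg A[G]}) (gmul << g >> y) =
  (mlin (fun l => << f l >> : {malg A[G]}) \o gmul << g >> : {linear _ -> _}) y
  by [].
have -> : gmul << f g >> (group_ring_map f y) =
  (gmul << f g >> \o mlin (fun l => << f l >> : {malg A[G]}) : {linear _ -> _}) y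
  by [].
apply: malg_ext => h /=.
by rewrite !gmulU !mlinU gmulU autM.
Qed.

Lemma group_ring_map_comp f g x :
  group_ring_map (f * g)%g x = group_ring_map f (group_ring_map g x).
Proof.
rewrite -[LHS]/(mlin (fun l => << (f * g)%g l >> : {malg A[G]}) x).
have -> : group_ring_map f (group_ring_map g x) =
  (mlin (fun l => << f l >> : {malg A[G]}) \o mlin (fun l => << g l >> : {malg A[G]})
    : {linear _ -> _}) x by [].
by apply: malg_ext => l /=; rewrite !mlinU.
Qed.

Lemma group_ring_map1 x : group_ring_map 1%g x = x.
Proof. by rewrite [RHS]malg_gen. Qed.

Lemma augmentation_map f x : augmentation (group_ring_map f x) = augmentation x.
Proof.
have := @malg_ext A G A^o
  (mlin (fun _ => 1 : A^o) \o mlin (fun l => << f l >> : {malg A[G]}))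
  (mlin (fun _ => 1 : A^o)); apply => l /=.
by rewrite !mlinU.
Qed.

Lemma aug_pow_map f n x : ideal_pow (@aug_ideal A G) n x ->
  ideal_pow (@aug_ideal A G) n (group_ring_map f x).
Proof.
elim: n x => [//|n IH] x /= [s [sI ->]].
exists [seq (group_ring_map f p.1, group_ring_map f p.2) | p <- s]; split.
  move=> _ /mapP[p /sI[p1 p2] ->] /=; split; last exact: IH.
  by rewrite /aug_ideal augmentation_map.
rewrite linear_sum big_map; apply: eq_bigr => p _ /=.
exact: group_ring_mapM.
Qed.

Lemma aug_powD n (x y : AG) : ideal_pow (@aug_ideal A G) n x ->
  ideal_pow (@aug_ideal A G) n y -> ideal_pow (@aug_ideal A G) n (x + y).
Proof.
case: n => [//|n] [s [sI ->]] [t [tI ->]]; exists (s ++ t); split.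
  by move=> p; rewrite mem_cat => /orP[/sI|/tI].
by rewrite big_cat.
Qed.

Lemma aug_powN n (x : AG) : ideal_pow (@aug_ideal A G) n x ->
  ideal_pow (@aug_ideal A G) n (- x).
Proof.
case: n => [//|n] [s [sI ->]]; exists [seq (- p.1, p.2) | p <- s]; split.
  move=> _ /mapP[p /sI[p1 p2] ->] /=; split=> //.
  by rewrite /aug_ideal /augmentation linearN /= -/(augmentation _) p1 oppr0.
by rewrite big_map -sumrN; apply: eq_bigr => p _; rewrite mulNr.
Qed.

(** [f \in johnson A k] iff [f] acts trivially on [A[G]/I^(k+1)]. *)
Definition johnson (k : nat) : {pred group_aut G} :=
  [pred f | `[< forall x : AG,
     ideal_pow (@aug_ideal A G) k.+1 (group_ring_map f x - x) >] ].

Lemma johnsonM k : mulg_closed (johnson k).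
Proof.
move=> f g /asboolP fJ /asboolP gJ; apply/asboolP => x.
rewrite group_ring_map_comp -(subrKA (group_ring_map g x)).
exact: aug_powD.
Qed.

Lemma johnson1 k : 1%g \in johnson k.
Proof.
apply/asboolP => x; rewrite group_ring_map1 subrr; exists [::]; split=> //.
by rewrite big_nil.
Qed.

Lemma johnsonV k : invg_closed (johnson k).
Proof.
move=> f /asboolP fJ; apply/asboolP => x.
have -> : group_ring_map f^-1%g x - x =
    - group_ring_map f^-1%g (group_ring_map f x - x).
  by rewrite linearB /= -group_ring_map_comp mulVg group_ring_map1 opprB.
exact/aug_powN/aug_pow_map.
Qed.

HB.instance Definition _ k := isMulClosed.Build (group_aut G) (johnson k) (@johnsonM k).
HB.instance Definition _ k := isMul1Closed.Build (group_aut G) (johnson k) (johnson1 k).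
HB.instance Definition _ k := isInvClosed.Build (group_aut G) (johnson k) (@johnsonV k).

Lemma johnson_conj k f g : f \in johnson k -> (g * f * g^-1)%g \in johnson k.
Proof.
move=> /asboolP fJ; apply/asboolP => x.
rewrite !group_ring_map_comp.
have {2}-> : x = group_ring_map g (group_ring_map g^-1%g x).
  by rewrite -group_ring_map_comp mulgV group_ring_map1.
by rewrite -linearB; exact: aug_pow_map.
Qed.

End Johnson.

(** For a family [V] of [A]-modules, [tensor V] is
      [\bigoplus_(p, i_1, .., i_p) V i_1 \otimes .. \otimes V i_p],
    that is, the tensor algebra of [\bigoplus_i V i]: the free module on the
    words [v_1 | .. | v_p] ([v_j] in [V i_j]) modulo linearity in each letter.
    With [I = unit] it is [\bigoplus_p M^{\otimes p}]. *)

Section Tensor.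
Variables (A : comNzRingType) (I : choiceType) (V : I -> lmodType A).

Definition letter : Type := {i : I & V i}.
Definition word : Type := seq letter.
HB.instance Definition _ := Choice.on letter.
HB.instance Definition _ := Choice.on word.

Definition mkletter i (v : V i) : letter := Tagged (fun i => V i : Type) v.

Definition multilinear (M : lmodType A) (F : word -> M) : Prop :=
  forall (u w : word) i a (v v' : V i),
    F (u ++ mkletter (a *: v + v') :: w) =
    a *: F (u ++ mkletter v :: w) + F (u ++ mkletter v' :: w).

Lemma multilinear0 (M : lmodType A) (F : word -> M) : multilinear F ->
  forall (u w : word) i, F (u ++ mkletter (0 : V i) :: w) = 0.
Proof.
move=> F_ml u w i; have := F_ml u w i (-1) 0 0.
by rewrite scaler0 addr0 scaleN1r addNr.
Qed.

Inductive multilinear_rel : {malg A[word]} -> Prop :=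
| MRel0 : multilinear_rel 0
| MRelP a x y : multilinear_rel x -> multilinear_rel y ->
    multilinear_rel (a *: x + y)
| MRelGen (u w : word) i a (v v' : V i) :
    multilinear_rel (<< (u ++ mkletter (a *: v + v') :: w : word) >>
      - (a *: << (u ++ mkletter v :: w : word) >>
         + << (u ++ mkletter v' :: w : word) >>)).

Definition mrel : {pred {malg A[word]}} := [pred x | `[< multilinear_rel x >] ].

Lemma mrel_zmod_closed : zmod_closed mrel.
Proof.
split=> [|x y /asboolP xR /asboolP yR]; apply/asboolP; first exact: MRel0.
rewrite addrC -scaleN1r; exact: MRelP.
Qed.
HB.instance Definition _ := GRing.isZmodClosed.Build _ mrel mrel_zmod_closed.

Definition tensor : Type := Quotient.quot (mrel : zmodClosed _).
HB.instance Definition _ := GRing.Zmodule.on tensor.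

Definition tpi (x : {malg A[word]}) : tensor := \pi_(Quotient.quot mrel) x.
Definition trepr (t : tensor) : {malg A[word]} := repr t.
Definition tpure (w : word) : tensor := tpi << w >>.

Lemma treprK : cancel trepr tpi. Proof. exact: reprK. Qed.

Lemma tpi_eq x y : tpi x = tpi y <-> multilinear_rel (x - y).
Proof.
split=> [/eqP|H]; first by rewrite -[_ == _]Quotient.idealrBE => /asboolP.
by apply/eqP; rewrite -[_ == _]Quotient.idealrBE; apply/asboolP.
Qed.

Lemma trepr_tpi x : multilinear_rel (trepr (tpi x) - x).
Proof. by apply/tpi_eq; rewrite treprK. Qed.

Definition tscale a (t : tensor) : tensor := tpi (a *: trepr t).

Lemma tpiD x y : tpi (x + y) = tpi x + tpi y.
Proof. exact: Quotient.pi_add. Qed.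

Lemma tpiZ a x : tpi (a *: x) = tscale a (tpi x).
Proof.
apply/esym/tpi_eq; rewrite -scalerBr -[X in multilinear_rel X]addr0.
by apply: MRelP; [exact: trepr_tpi | exact: MRel0].
Qed.

Lemma tscaleA a b t : tscale a (tscale b t) = tscale (a * b) t.
Proof. by rewrite -[t]treprK -!tpiZ scalerA. Qed.
Lemma tscale1 t : tscale 1 t = t.
Proof. by rewrite -[t]treprK -!tpiZ scale1r. Qed.
Lemma tscaleDr a : {morph tscale a : t s / t + s}.
Proof. by move=> t s; rewrite -[t]treprK -[s]treprK -tpiD -!tpiZ scalerDr tpiD. Qed.
Lemma tscaleDl t : {morph tscale^~ t : a b / a + b}.
Proof. by move=> a b; rewrite -[t]treprK -!tpiZ scalerDl tpiD. Qed.

HB.instance Definition _ := GRing.Zmodule_isLmodule.Build A tensor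
  tscaleA tscale1 tscaleDr tscaleDl.

Lemma tpi_linear : linear tpi.
Proof. by move=> a x y; rewrite tpiD tpiZ. Qed.
HB.instance Definition _ :=
  GRing.isLinear.Build A {malg A[word]} tensor *:%R tpi tpi_linear.

Lemma tpure_multilinear : multilinear tpure.
Proof.
by move=> u w i a v v'; rewrite /tpure -linearP; apply/tpi_eq; exact: MRelGen.
Qed.

(** The linear map [tensor V -> M] with prescribed values on words; it is
    meaningful when [F] is multilinear (lemmas [tlift_linear], [tlift_pure]). *)
Definition tlift (M : lmodType A) (F : word -> M) (t : tensor) : M :=
  mlin F (trepr t).

Section Lift.
Variables (M : lmodType A) (F : word -> M).
Hypothesis F_ml : multilinear F.

Lemma mlin_rel x : multilinear_rel x -> mlin F x = 0.
Proof.
elim=> [|a {}x y _ xE _ yE|u w i a v v']; first exact: linear0.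
  by rewrite linearP /= xE yE scaler0 addr0.
by rewrite linearB linearP /= !mlinU F_ml subrr.
Qed.

Lemma tlift_pi x : tlift F (tpi x) = mlin F x.
Proof.
by have /eqP := mlin_rel (trepr_tpi x); rewrite linearB /= subr_eq0 => /eqP.
Qed.

Lemma tlift_linear : linear (tlift F).
Proof.
by move=> a t s; rewrite -[t]treprK -[s]treprK -linearP !tlift_pi linearP.
Qed.

Lemma tlift_pure w : tlift F (tpure w) = F w.
Proof. by rewrite tlift_pi mlinU. Qed.

End Lift.

Lemma tensor_ext (M : lmodType A) (f g : tensor -> M) :
  linear f -> linear g -> (forall w, f (tpure w) = g (tpure w)) -> f =1 g.
Proof.
move=> fL gL fg t; rewrite -[t]treprK.
pose f' : {linear tensor -> M} := HB.pack f (GRing.isLinear.Build _ _ _ _ f fL).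
pose g' : {linear tensor -> M} := HB.pack g (GRing.isLinear.Build _ _ _ _ g gL).
by have := @malg_ext A word M (f' \o tpi) (g' \o tpi) fg (trepr t).
Qed.

(** The submodule spanned by the words satisfying [P]. *)
Definition tspan (P : pred word) : {pred tensor} :=
  [pred t | `[< exists2 x : {malg A[word]},
                  {subset msupp x <= P} & t = tpi x >] ].

Lemma tspan_submod P : submod_closed (tspan P).
Proof.
split=> [|a t s /asboolP[x xP ->] /asboolP[y yP ->]]; apply/asboolP.
  by exists 0; rewrite ?linear0 // => w; rewrite msupp0.
exists (a *: x + y); rewrite ?linearP // => w /(fsubsetP (msuppD_le _ _)).
by rewrite in_fsetU => /orP[/(fsubsetP (msuppZ_le _ _))/xP|/yP].
Qed.
HB.instance Definition _ P :=
  GRing.isSubmodClosed.Build A tensor (tspan P) (tspan_submod P).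

Lemma tpure_span (P : pred word) w : P w -> tpure w \in tspan P.
Proof.
move=> Pw; apply/asboolP; exists << w >> => // w'.
by move=> /(fsubsetP msuppU_le); rewrite inE => /eqP ->.
Qed.

Lemma tspan_lift (P : pred word) (M : lmodType A) (N : submodClosed M)
    (F : word -> M) : multilinear F -> (forall w, P w -> F w \in N) ->
  forall t, t \in tspan P -> tlift F t \in N.
Proof.
move=> F_ml FN t /asboolP[x xP ->]; rewrite tlift_pi // /mlin big_seq.
by apply: rpred_sum => w /xP /FN FwN; exact: rpredZ.
Qed.

End Tensor.

Section TensorMap.
Variables (A : comNzRingType) (I J : choiceType).
Variables (V : I -> lmodType A) (W : J -> lmodType A).
Variables (r : I -> J) (f : forall i, V i -> W (r i)).

Definition map_letter (l : letter V) : letter W := mkletter (f (tagged l)).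

Definition tmap : tensor V -> tensor W :=
  tlift (fun w : word V => tpure (map map_letter w : word W)).

Hypothesis f_linear : forall i, linear (@f i).

Lemma tmap_multilinear :
  multilinear (fun w : word V => tpure (map map_letter w : word W)).
Proof.
move=> u w i a v v'; rewrite !map_cat /= /map_letter /= f_linear.
exact: tpure_multilinear.
Qed.

Lemma tmap_linear : linear tmap.
Proof. exact/tlift_linear/tmap_multilinear. Qed.

Lemma tmap_pure w : tmap (tpure w) = tpure (map map_letter w : word W).
Proof. by rewrite /tmap tlift_pure //; exact: tmap_multilinear. Qed.

Lemma tmap_span (P : pred (word V)) (Q : pred (word W)) :
  (forall w, P w -> Q (map map_letter w)) ->
  forall t, t \in tspan P -> tmap t \in tspan Q.
Proof.
move=> PQ; apply: tspan_lift; first exact: tmap_multilinear.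
by move=> w /PQ Qw; exact: tpure_span.
Qed.

End TensorMap.

Notation talg M := (tensor (fun _ : unit => M)).

Definition tvec (A : comNzRingType) (M : lmodType A) (x : M) :
  letter (fun _ : unit => M) := mkletter (i := tt) x.

Definition tpow (A : comNzRingType) (M : lmodType A) (n : nat) : {pred talg M} :=
  tspan (fun w : word (fun _ : unit => M) => size w == n).

Section Cochains.
Variables (A : comNzRingType) (G : groupType).
Implicit Types n p q : nat.

Definition simplex n : Type := 'I_n -> G.

(** The [i]-th face ([0 <= i <= n.+1]): [i = 0] and [i = n.+1] drop the first and
    the last entry, the other faces multiply two consecutive entries. *)
Definition face n (i : nat) (s : simplex n.+1) : simplex n := fun j =>
  let s0 := s (widen_ord (leqnSn n) j) in
  let s1 := s (lift ord0 j) in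
  if (j.+1 < i)%N then s0 else if j.+1 == i then (s0 * s1)%g else s1.

Definition degenerate n (s : simplex n) : Prop := exists i, s i = 1%g.

Definition cobd n (c : simplex n -> A^o) : simplex n.+1 -> A^o :=
  fun s => \sum_(i < n.+2) (-1) ^+ i * c (face i s).

Definition cup p q (a : simplex p -> A^o) (b : simplex q -> A^o) :
    simplex (p + q) -> A^o :=
  fun s => a (fun j => s (lshift q j)) * b (fun j => s (rshift p j)).

(** The augmentation ideal of the algebra of normalized cochains. The
    augmentation is the restriction to the basepoint, whose normalized cochains
    vanish in positive degree: for [0 < n] the second condition follows from the
    first one, and for [n = 0] it says that [c] is zero. *)
Definition reduced n : {pred simplex n -> A^o} :=
  [pred c | `[< (forall s, degenerate s -> c s = 0) /\
                c (fun=> 1%g) = 0 >] ].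

Lemma reduced_submod n : submod_closed (@reduced n).
Proof.
split=> [|a c c' /asboolP[c1 c2] /asboolP[c1' c2']]; apply/asboolP; first by [].
split=> [s ds|].
  by rewrite -[LHS]/(a *: c s + c' s) c1 // c1' // scaler0 addr0.
by rewrite -[LHS]/(a *: c (fun=> 1%g) + c' (fun=> 1%g)) c2 c2' scaler0 addr0.
Qed.
HB.instance Definition _ n :=
  GRing.isSubmodClosed.Build A (simplex n -> A^o) (@reduced n)
    (reduced_submod n).

Record cochain n := MkCochain {
  cval :> simplex n -> A^o;
  cval_reduced : cval \in @reduced n
}.

HB.instance Definition _ n := [isSub for @cval n].
HB.instance Definition _ n := [Choice of cochain n by <:].
HB.instance Definition _ n := [SubChoice_isSubLmodule of cochain n by <:].

Lemma cochain_ext n (c c' : cochain n) : cval c =1 cval c' -> c = c'.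
Proof. by move=> /funext cc'; apply: val_inj. Qed.

Lemma cochainPE n a (c c' : cochain n) s :
  cval (a *: c + c') s = a * c s + c' s.
Proof. by []. Qed.

Lemma cochain0 (c : cochain 0) : c = 0.
Proof.
apply: cochain_ext => s; have /asboolP[_ c0] := cval_reduced c.
by have -> : s = (fun=> 1%g) by apply: funext => -[].
Qed.

Lemma face_degenerate n (s : simplex n.+1) (k : 'I_n.+1) (i : nat) :
  s k = 1%g -> (i < n.+2)%N -> i != k -> i != k.+1 -> degenerate (face i s).
Proof.
move=> sk1 ilt ik ik1; have [iltk|kltj] := ltnP i k.
  case: k => -[//|k] klt in sk1 ik ik1 iltk *.
  exists (Ordinal (klt : (k < n)%N)); rewrite /face /=.
  rewrite [(k.+1 < i)%N]ltnNge (ltnW iltk) /= gtn_eqF //.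
  by rewrite -[RHS]sk1; congr (s _); apply: val_inj.
have ki : (k.+1 < i)%N by rewrite ltn_neqAle eq_sym ik1 ltn_neqAle eq_sym ik.
have kn : (k < n)%N by rewrite -ltnS (leq_trans ki).
exists (Ordinal kn); rewrite /face /= ki.
by rewrite -[RHS]sk1; congr (s _); apply: val_inj.
Qed.

Lemma face_adjacent n (s : simplex n.+1) (k : 'I_n.+1) :
  s k = 1%g -> face k s = face k.+1 s.
Proof.
move=> sk1; apply: funext => j; rewrite /face.
have [jk|kj|jk] := ltngtP j.+1 k.
- by rewrite ltnW.
- rewrite ltnNge kj /= eqSS; case: eqP => // jk.
  have -> : widen_ord (leqnSn n) j = k by exact: val_inj.
  by rewrite sk1 mul1g.
- rewrite jk leqnn.
  have -> : lift ord0 j = k by exact: val_inj.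
  by rewrite sk1 mulg1.
Qed.

Lemma cobd_reduced n (c : cochain n) : cobd c \in @reduced n.+1.
Proof.
have /asboolP[c0 _] := cval_reduced c; apply/asboolP.
have main s : degenerate s -> cobd c s = 0.
  case=> k sk1; rewrite /cobd.
  have k1 : (k < n.+2)%N by rewrite ltnW // ltnS.
  have k2 : (k.+1 < n.+2)%N by rewrite ltnS.
  rewrite (bigD1 (Ordinal k1)) //= (bigD1 (Ordinal k2)) /=; last first.
    by rewrite -val_eqE /= gtn_eqF.
  rewrite big1 ?addr0; last first.
    move=> i /andP[ik ik1]; rewrite c0 ?mulr0 //.
    by apply: (face_degenerate sk1) => //; rewrite -?val_eqE in ik ik1 *.
  by rewrite (face_adjacent sk1) exprS mulN1r mulNr subrr.
by split=> //; apply: main; exists ord0.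
Qed.

Definition cochain_d n (c : cochain n) : cochain n.+1 :=
  MkCochain (cobd_reduced c).

Lemma cup_reduced p q (a : cochain p) (b : cochain q) :
  cup a b \in @reduced (p + q).
Proof.
have /asboolP[a0 a1] := cval_reduced a; have /asboolP[b0 b1] := cval_reduced b.
apply/asboolP; split; last by rewrite /cup a1 mul0r.
move=> s [k sk1]; rewrite /cup; case: (split_ordP k) => j kE.
  by rewrite a0 ?mul0r //; exists j; rewrite -kE.
by rewrite b0 ?mulr0 //; exists j; rewrite -kE.
Qed.

Definition cochain_cup p q (a : cochain p) (b : cochain q) : cochain (p + q) :=
  MkCochain (cup_reduced a b).

Lemma cochain_dE n (c : cochain n) s :
  cval (cochain_d c) s = \sum_(i < n.+2) (-1) ^+ i * c (face i s).
Proof. by []. Qed.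

Lemma cochain_cupE p q (a : cochain p) (b : cochain q) s :
  cval (cochain_cup a b) s
  = a (fun j => s (lshift q j)) * b (fun j => s (rshift p j)).
Proof. by []. Qed.

Lemma cochain_d_linear n : linear (@cochain_d n).
Proof.
move=> a c c'; apply: cochain_ext => s.
rewrite cochainPE !cochain_dE mulr_sumr -big_split.
by apply: eq_bigr => i _; rewrite cochainPE mulrDr mulrCA.
Qed.

Lemma cochain_cupPl p q (b : cochain q) :
  linear (fun a : cochain p => cochain_cup a b).
Proof.
move=> x a a'; apply: cochain_ext => s.
by rewrite cochainPE !cochain_cupE cochainPE mulrDl mulrA.
Qed.

Lemma cochain_cupPr p q (a : cochain p) :
  linear (fun b : cochain q => cochain_cup a b).
Proof.
move=> x b b'; apply: cochain_ext => s.
by rewrite cochainPE !cochain_cupE cochainPE mulrDr mulrCA.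
Qed.

(** First cohomology [H^1(G; A) = Hom(G, A)]. *)
Definition is_hom : {pred G -> A^o} :=
  [pred h | `[< forall x y, h (x * y)%g = h x + h y >] ].

Lemma is_hom_submod : submod_closed is_hom.
Proof.
split=> [|a h h' /asboolP hM /asboolP hM']; apply/asboolP => x y.
  by rewrite addr0.
rewrite -[LHS]/(a *: h _ + h' _) hM hM' scalerDr addrACA.
by [].
Qed.
HB.instance Definition _ :=
  GRing.isSubmodClosed.Build A (G -> A^o) is_hom is_hom_submod.

Record H1 := MkH1 { hval :> G -> A^o; hval_hom : hval \in is_hom }.

HB.instance Definition _ := [isSub for hval].
HB.instance Definition _ := [Choice of H1 by <:].
HB.instance Definition _ := [SubChoice_isSubLmodule of H1 by <:].

Lemma H1_ext (h h' : H1) : hval h =1 hval h' -> h = h'.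
Proof. by move=> /funext hh'; apply: val_inj. Qed.

Lemma H1_reduced (h : H1) : (fun s : simplex 1 => h (s ord0)) \in @reduced 1.
Proof.
have /asboolP hM := hval_hom h.
have h1 : h 1%g = 0 by apply: (addIr (h 1%g)); rewrite -hM mul1g add0r.
by apply/asboolP; split=> // s [i]; rewrite (ord1 i) => ->.
Qed.

Definition H1_cochain (h : H1) : cochain 1 := MkCochain (H1_reduced h).

Lemma H1_cochain_linear : linear H1_cochain.
Proof. by move=> a h h'; apply: cochain_ext. Qed.

End Cochains.

Section Pullback.
Variables (A : comNzRingType) (G : groupType) (f : group_aut G).

Lemma pull_reduced n (c : cochain A G n) : (fun s => c (f \o s)) \in @reduced A G n.
Proof.
have /asboolP[c0 c1] := cval_reduced c; apply/asboolP; split.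
  by move=> s [i si]; apply: c0; exists i; rewrite /= si aut1.
by rewrite -[RHS]c1; congr (cval c _); apply: funext => i /=; rewrite aut1.
Qed.

Definition pull_cochain n (c : cochain A G n) : cochain A G n :=
  MkCochain (pull_reduced c).

Lemma pull_cochain_linear n : linear (@pull_cochain n).
Proof. by move=> a c c'; apply: cochain_ext. Qed.

Lemma pull_face n i (s : simplex G n.+1) : face i (f \o s) = f \o face i s.
Proof.
by apply: funext => j; rewrite /face /=; case: ifP => // _; case: ifP; rewrite ?autM.
Qed.

Lemma pull_cochain_d n (c : cochain A G n) :
  pull_cochain (cochain_d c) = cochain_d (pull_cochain c).
Proof.
apply: cochain_ext => s; rewrite /= /cobd; apply: eq_bigr => i _.
by rewrite pull_face.
Qed.

Lemma pull_cochain_cup p q (a : cochain A G p) (b : cochain A G q) :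
  pull_cochain (cochain_cup a b) = cochain_cup (pull_cochain a) (pull_cochain b).
Proof. exact: cochain_ext. Qed.

Lemma pull_is_hom (h : H1 A G) : (fun x => h (f x)) \in @is_hom A G.
Proof.
by have /asboolP hM := hval_hom h; apply/asboolP => x y; rewrite autM hM.
Qed.

Definition pull_H1 (h : H1 A G) : H1 A G := MkH1 (pull_is_hom h).

Lemma pull_H1_linear : linear pull_H1.
Proof. by move=> a h h'; apply: H1_ext. Qed.
HB.instance Definition _ :=
  GRing.isLinear.Build A (H1 A G) (H1 A G) *:%R pull_H1 pull_H1_linear.

Lemma pull_H1_cochain h : pull_cochain (H1_cochain h) = H1_cochain (pull_H1 h).
Proof. exact: cochain_ext. Qed.

End Pullback.

(** [Bar(C)] for [C] the normalized cochains of [BG]: the word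
    [c_1 | .. | c_p] of reduced cochains has weight [p] and degree
    [\sum_i (|c_i| - 1)], where [|c|] is the tag of the letter [c]. *)
Notation Bar A G := (tensor (cochain A G)).

Section Bar.
Variables (A : comNzRingType) (G : groupType).
Local Notation C := (cochain A G).
Local Notation bword := (word C).
Local Notation Bar := (Bar A G).

Definition bar_word (w : bword) : Bar := tpure w.

Definition word_deg (w : bword) : int := \sum_(l <- w) ((tag l)%:Z - 1).

Definition bar_deg (m : int) : {pred Bar} := tspan (fun w => word_deg w == m).

Definition bar_wt (m : int) : {pred Bar} :=
  tspan (fun w : bword => (size w)%:Z <= m).

Definition letter_d (l : letter C) : letter C := mkletter (cochain_d (tagged l)).

Definition letter_cup (l l' : letter C) : letter C :=
  mkletter (cochain_cup (tagged l) (tagged l')).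

(** [(-1)^(p + |c_1| + .. + |c_p|)] *)
Definition word_sign (w : bword) : A := (-1) ^+ (\sum_(l <- w) (tag l).+1).

Definition letter0 : letter C := mkletter (0 : C 0).

Definition bar_d1_word (w : bword) : Bar :=
  - \sum_(i < size w) word_sign (take i w) *:
      bar_word (take i w ++ letter_d (nth letter0 w i) :: drop i.+1 w).

Definition bar_d2_word (w : bword) : Bar :=
  - \sum_(i < (size w).-1) word_sign (take i.+1 w) *:
      bar_word (take i w
        ++ letter_cup (nth letter0 w i) (nth letter0 w i.+1) :: drop i.+2 w).

Definition bar_d_word (w : bword) : Bar := bar_d1_word w + bar_d2_word w.

Definition bar_d : Bar -> Bar := tlift bar_d_word.

Lemma drop_cat_le (T : Type) n (u x : seq T) : (n <= size u)%N ->
  drop n (u ++ x) = drop n u ++ x.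
Proof.
rewrite leq_eqVlt => /orP[/eqP->|nu]; last by rewrite drop_cat nu.
by rewrite drop_size_cat // drop_size.
Qed.

Lemma word_sign_map (w w' : bword) :
  map (fun l => tag l) w = map (fun l => tag l) w' -> word_sign w = word_sign w'.
Proof.
move=> ww'; rewrite /word_sign; congr (_ ^+ _).
transitivity (\sum_(n <- map (fun l : letter C => tag l) w) n.+1)%N.
  by rewrite big_map.
by rewrite ww' big_map.
Qed.

Lemma word_sign_take (u w : bword) n (v v' : C n) i :
  word_sign (take i (u ++ mkletter v :: w))
  = word_sign (take i (u ++ mkletter v' :: w)).
Proof. by apply: word_sign_map; rewrite !map_take !map_cat. Qed.

Lemma bar_d1_multilinear : multilinear bar_d1_word.
Proof.
move=> u w n a v v'; rewrite /bar_d1_word !size_cat /=.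
rewrite scalerN -opprD scaler_sumr -big_split /=; congr (- _).
apply: eq_bigr => i _.
rewrite (word_sign_take _ _ _ v) (word_sign_take _ _ v' v).
rewrite scalerA mulrC -scalerA -scalerDr; congr (_ *: _).
move: (nat_of_ord i) => {}i.
have [iu|ui|iu] := ltngtP i (size u).
- rewrite !nth_cat iu !takel_cat ?(ltnW iu) // !drop_cat_le //.
  rewrite -!cat_cons !catA; exact: tpure_multilinear.
- rewrite !nth_cat !take_cat !drop_cat ltnNge (ltnW ui) /=.
  rewrite ltnNge leqW ?(ltnW ui) //= subSn ?(ltnW ui) //.
  rewrite -[(i - size u)%N]prednK ?subn_gt0 //= -!catA /=.
  exact: tpure_multilinear.
- rewrite iu !nth_cat ltnn subnn /= !take_size_cat //.
  rewrite !drop_cat ltnNge leqnSn /= subSn // subnn /= !drop0.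
  rewrite /letter_d /= cochain_d_linear; exact: tpure_multilinear.
Qed.

Lemma bar_d2_multilinear : multilinear bar_d2_word.
Proof.
move=> u w n a v v'; rewrite /bar_d2_word !size_cat /=.
rewrite scalerN -opprD scaler_sumr -big_split /=; congr (- _).
apply: eq_bigr => i _.
rewrite (word_sign_take _ _ _ v) (word_sign_take _ _ v' v).
rewrite scalerA mulrC -scalerA -scalerDr; congr (_ *: _).
move: (nat_of_ord i) => {}i.
have [iu|ui|iu] := ltngtP i.+1 (size u).
- have iu' := ltnW iu; rewrite !nth_cat iu iu' !takel_cat ?(ltnW iu') //.
  rewrite !drop_cat_le // -!cat_cons !catA; exact: tpure_multilinear.
- rewrite ltnS in ui; rewrite !nth_cat !take_cat !drop_cat.
  rewrite [(i < _)%N]ltnNge ui [(i.+1 < _)%N]ltnNge leqW //=.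
  rewrite [(i.+2 < _)%N]ltnNge !leqW //= !subSn ?leqW //.
  case: (i - size u)%N => [|m] /=.
    rewrite !cats0 /letter_cup /= cochain_cupPl; exact: tpure_multilinear.
  rewrite -!catA /=; exact: tpure_multilinear.
- rewrite !nth_cat -iu ltnSn ltnn subnn /= !takel_cat -?iu //.
  rewrite !drop_cat -iu ltnNge leqnSn /= subSn // subnn /= !drop0.
  rewrite /letter_cup /= cochain_cupPr; exact: tpure_multilinear.
Qed.

Lemma bar_d_multilinear : multilinear bar_d_word.
Proof.
move=> u w n a v v'; rewrite /bar_d_word bar_d1_multilinear bar_d2_multilinear.
by rewrite scalerDr addrACA.
Qed.

Lemma bar_d_linear : linear bar_d.
Proof. exact/tlift_linear/bar_d_multilinear. Qed.
HB.instance Definition _ := GRing.isLinear.Build A Bar Bar *:%R bar_d bar_d_linear.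

Lemma bar_d_wordE w : bar_d (bar_word w) = bar_d_word w.
Proof. exact/tlift_pure/bar_d_multilinear. Qed.

(** There is nothing in degree [-1], so that [H^0(Bar)] has no boundaries and is
    the module of [0]-cocycles. *)
Lemma bar_degN1 (T : Bar) : T \in bar_deg (-1) -> T = 0.
Proof.
move=> /asboolP[x xP ->]; rewrite [x]malg_gen /mlin linear_sum big_seq big1 //.
move=> w /xP /eqP wdeg; rewrite linearZ /=.
suff : tpi << w >> = 0 :> tensor C by move->; rewrite scaler0.
have : has (fun l => tag l == 0%N) w.
  apply: contraT => /hasPn w0.
  have : 0 <= word_deg w.
    rewrite /word_deg big_seq; apply: sumr_ge0 => l /w0 l0.
    by rewrite subr_ge0 lez_nat lt0n.
  by rewrite wdeg.
case/hasP=> -[n c] lw /= /eqP n0; move: n0 c lw => -> c /[!(cochain0 c)].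
case/splitPr=> u w'; exact: (multilinear0 (@tpure_multilinear _ _ C)).
Qed.

End Bar.
Section Coalgebra.
Variables (A : comNzRingType) (G : groupType).
Local Notation C := (cochain A G).
Local Notation bword := (word C).
Local Notation Bar := (Bar A G).
Local Notation T := (talg Bar).
Local Notation tword := (word (fun _ : unit => Bar)).

Definition bar_one : Bar := bar_word [::].

(** [x1 | .. | xm] in [Bar^{\otimes m}] *)
Definition bar_tensor (s : seq Bar) : T := tpure (map (@tvec A Bar) s).

Definition bar_counit_word (w : bword) : A^o := (w == [::])%:R.

Definition bar_counit (x : Bar) : A := tlift bar_counit_word x.

Definition bar_coprod_word (w : bword) : T :=
  \sum_(i < (size w).+1) bar_tensor [:: bar_word (take i w); bar_word (drop i w)].

Definition bar_coprod : Bar -> T := tlift bar_coprod_word.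

(** The projection of [Bar] onto the kernel of the counit. *)
Definition bar_red (x : Bar) : Bar := x - bar_counit x *: bar_one.

(** On the kernel of the counit this is [\Delta x - x \otimes 1 - 1 \otimes x];
    it is extended by [0] on [bar_one]. *)
Definition bar_redcoprod (x : Bar) : T :=
  bar_coprod (bar_red x) - bar_tensor [:: bar_red x; bar_one]
  - bar_tensor [:: bar_one; bar_red x].

Definition tcat (t : T) (w : tword) : T :=
  tlift (fun v : tword => (tpure (v ++ w : tword) : T)) t.

(** [\bar\Delta \otimes id \otimes .. \otimes id] *)
Definition redcoprod_head_word (w : tword) : T :=
  if w is l :: w' then tcat (bar_redcoprod (tagged l)) w' else 0.

Definition redcoprod_head : T -> T := tlift redcoprod_head_word.

(** [\bar\Delta^n], with values in [Bar^{\otimes n.+1}] *)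
Definition redcoprod_iter (n : nat) (x : Bar) : T :=
  iter n redcoprod_head (bar_tensor [:: bar_red x]).

Lemma bar_counit_multilinear : multilinear bar_counit_word.
Proof.
by move=> [|? ?] w i a v v'; rewrite /bar_counit_word /= scaler0 addr0.
Qed.

Lemma bar_counit_linear : linear (bar_counit : Bar -> A^o).
Proof. exact/tlift_linear/bar_counit_multilinear. Qed.

Lemma bar_counitE w : bar_counit (bar_word w) = (w == [::])%:R.
Proof. exact: (tlift_pure bar_counit_multilinear). Qed.

Lemma bar_tensor2Pl a x x' y :
  bar_tensor [:: a *: x + x'; y] = a *: bar_tensor [:: x; y] + bar_tensor [:: x'; y].
Proof.
exact: (@tpure_multilinear A unit (fun _ => Bar) [::] [:: tvec y] tt).
Qed.

Lemma bar_tensor2Pr a x y y' :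
  bar_tensor [:: x; a *: y + y'] = a *: bar_tensor [:: x; y] + bar_tensor [:: x; y'].
Proof.
exact: (@tpure_multilinear A unit (fun _ => Bar) [:: tvec x] [::] tt).
Qed.

Lemma bar_coprod_multilinear : multilinear bar_coprod_word.
Proof.
move=> u w n a v v'; rewrite /bar_coprod_word !size_cat /=.
rewrite scaler_sumr -big_split; apply: eq_bigr => i _ /=.
move: (nat_of_ord i) => {}i; have [iu|ui] := leqP i (size u).
  rewrite !takel_cat // !drop_cat_le // -bar_tensor2Pr; congr bar_tensor.
  congr [:: _; _]; exact: tpure_multilinear.
rewrite !take_cat !drop_cat ltnNge (ltnW ui) /=.
rewrite -[(i - size u)%N]prednK ?subn_gt0 //= -bar_tensor2Pl; congr bar_tensor.
congr [:: _; _]; exact: tpure_multilinear.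
Qed.

Lemma bar_coprod_linear : linear bar_coprod.
Proof. exact/tlift_linear/bar_coprod_multilinear. Qed.

Lemma bar_coprodE w : bar_coprod (bar_word w) = bar_coprod_word w.
Proof. exact/tlift_pure/bar_coprod_multilinear. Qed.

Lemma bar_red_linear : linear bar_red.
Proof.
move=> a x y; rewrite /bar_red bar_counit_linear scalerDl -scalerA scalerBr.
by rewrite opprD addrACA.
Qed.

Lemma linear_sub (U V : lmodType A) (f g : U -> V) :
  linear f -> linear g -> linear (fun x => f x - g x).
Proof. by move=> fL gL a x y; rewrite fL gL scalerBr opprD addrACA. Qed.

Lemma bar_redcoprod_linear : linear bar_redcoprod.
Proof.
apply: linear_sub => [|a x y]; last by rewrite bar_red_linear bar_tensor2Pr.
apply: linear_sub => a x y; first by rewrite bar_red_linear bar_coprod_linear.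
by rewrite bar_red_linear bar_tensor2Pl.
Qed.

Lemma tcat_multilinear w :
  multilinear (fun v : tword => (tpure (v ++ w : tword) : T)).
Proof. by move=> u w' i a v v'; rewrite -!catA /= tpure_multilinear. Qed.

Lemma tcat_linear w : linear (tcat^~ w).
Proof. exact/tlift_linear/tcat_multilinear. Qed.

Lemma redcoprod_head_multilinear : multilinear redcoprod_head_word.
Proof.
move=> [|l u] w [] a v v' /=; first by rewrite bar_redcoprod_linear tcat_linear.
rewrite /tcat /tlift /mlin scaler_sumr -big_split; apply: eq_bigr => x _ /=.
rewrite scalerA mulrC -scalerA -scalerDr !catA; congr (_ *: _).
exact: tpure_multilinear.
Qed.

Lemma redcoprod_head_linear : linear redcoprod_head.
Proof. exact/tlift_linear/redcoprod_head_multilinear. Qed.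

Definition bar_H1 (h : H1 A G) : Bar := bar_word [:: mkletter (H1_cochain h)].

Lemma bar_H1_linear : linear bar_H1.
Proof.
move=> a h h'; rewrite /bar_H1 H1_cochain_linear.
exact: (@tpure_multilinear A nat C [::] [::] 1%N).
Qed.

Definition H0_Bar : {pred Bar} :=
  [pred x : Bar | (x \in @bar_deg A G 0) && (bar_d x == 0)].

Definition H0_Bar_le (n : nat) : {pred Bar} :=
  [pred x : Bar | (x \in H0_Bar) && (x \in @bar_wt A G n)].

(** [is_lead n x t] says that [t] in [H^{\otimes n}] is the leading term
    [\bar\Delta^(n-1) x] of [x]; both sides are mapped to [Bar^{\otimes n}], where
    the coproduct of the coalgebra [Bar] takes its values. *)
Definition is_lead (n : nat) (x : Bar) (t : talg (H1 A G)) : Prop :=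
  t \in @tpow A (H1 A G) n /\
  tmap (r := id) (fun _ : unit => bar_H1) t = redcoprod_iter n.-1 x.

(** [Z^r] in weight [n] and degree [0]: the elements of weight [<= n] whose
    differential has weight [<= n - r]. *)
Definition wss_cycle (r n : int) : {pred Bar} :=
  [pred x : Bar | [&& x \in @bar_deg A G 0, x \in @bar_wt A G n
                    & bar_d x \in @bar_wt A G (n - r)]].

(** The class in [E_1] (that is, modulo weight [< n]) of a tensor in
    [H^{\otimes n}]. *)
Definition symbol : talg (H1 A G) -> Bar :=
  tmap (V := fun _ : unit => H1 A G) (W := C) (r := fun=> 1%N)
       (fun _ : unit => @H1_cochain A G).

(** The differential [d_r] is defined and vanishes at [t] in [H^{\otimes n}]:
    the class of [t] has a representative [x] in [Z^r], and [d_r [x] = [bar_d x]]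
    is zero in [E_r], i.e. [bar_d x] lies in [bar_d Z^(r-1)] up to weight
    [< n - r]. *)
Definition wss_vanish (n r : int) (t : talg (H1 A G)) : Prop :=
  exists x y : Bar,
    [/\ x \in wss_cycle r n, x - symbol t \in @bar_wt A G (n - 1),
        y \in wss_cycle (r - 1) (n - 1)
      & bar_d x - bar_d y \in @bar_wt A G (n - r - 1)].

(** [K_n]: the tensors on which all the differentials (the cup product for
    [r = 1] and the higher Massey products) are defined and vanish. *)
Definition massey_vanish (n : nat) : {pred talg (H1 A G)} :=
  [pred t | (t \in @tpow A (H1 A G) n) &&
     `[< forall r : nat, (0 < r)%N -> wss_vanish n r t >] ].

Lemma symbol_linear : linear symbol.
Proof. apply: tmap_linear => _; exact: H1_cochain_linear. Qed.

Lemma wss_cycle_linear r n a x y : x \in wss_cycle r n -> y \in wss_cycle r n ->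
  a *: x + y \in wss_cycle r n.
Proof.
move=> /and3P[x1 x2 x3] /and3P[y1 y2 y3]; apply/and3P; rewrite linearP /=.
by split; rewrite rpredD // rpredZ.
Qed.

Lemma wss_cycle0 r n : 0 \in wss_cycle r n.
Proof. by apply/and3P; rewrite linear0; split; exact: rpred0. Qed.

Lemma massey_vanish_submod n : submod_closed (massey_vanish n).
Proof.
have sym0 : symbol 0 = 0.
  have := symbol_linear (-1) 0 0.
  by rewrite scaler0 addr0 scaleN1r addNr.
split=> [|a t s /andP[t1 /asboolP t2] /andP[s1 /asboolP s2]].
  apply/andP; split; first exact: rpred0.
  apply/asboolP => r _; exists 0, 0; split; try exact: wss_cycle0.
    by rewrite sym0 subr0 rpred0.
  by rewrite linear0 subr0 rpred0.
apply/andP; split; first by rewrite rpredD // rpredZ.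
apply/asboolP => r r0.
have [x [y [x1 x2 y1 y2]]] := t2 r r0; have [x' [y' [x1' x2' y1' y2']]] := s2 r r0.
exists (a *: x + x'), (a *: y + y'); split; try exact: wss_cycle_linear.
  by rewrite symbol_linear opprD addrACA -scalerBr rpredD // rpredZ.
by rewrite !bar_d_linear opprD addrACA -scalerBr rpredD // rpredZ.
Qed.
HB.instance Definition _ n :=
  GRing.isSubmodClosed.Build A (talg (H1 A G)) (massey_vanish n)
    (massey_vanish_submod n).

Record massey_kernel (n : nat) := MkMassey {
  mval :> talg (H1 A G);
  mvalP : mval \in massey_vanish n
}.

HB.instance Definition _ n := [isSub for @mval n].
HB.instance Definition _ n := [Choice of massey_kernel n by <:].
HB.instance Definition _ n := [SubChoice_isSubLmodule of massey_kernel n by <:].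

End Coalgebra.

Section PullbackBar.
Variables (A : comNzRingType) (G : groupType) (f : group_aut G).
Local Notation C := (cochain A G).
Local Notation Bar := (Bar A G).
Local Notation pull_letter := (@map_letter A nat nat C C id (@pull_cochain A G f)).

Definition pull_bar : Bar -> Bar :=
  tmap (V := C) (W := C) (r := id) (@pull_cochain A G f).

Definition pull_talg : talg (H1 A G) -> talg (H1 A G) :=
  tmap (r := id) (fun _ : unit => @pull_H1 A G f).

Lemma pull_bar_linear : linear pull_bar.
Proof. apply: tmap_linear => n; exact: pull_cochain_linear. Qed.
HB.instance Definition _ :=
  GRing.isLinear.Build A Bar Bar *:%R pull_bar pull_bar_linear.

Lemma pull_talg_linear : linear pull_talg.
Proof. apply: tmap_linear => _; exact: pull_H1_linear. Qed.

Lemma pull_barE (w : word C) : pull_bar (bar_word w) = bar_word (map pull_letter w).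
Proof. apply: tmap_pure => n; exact: pull_cochain_linear. Qed.

Lemma pull_nth (w : word C) i :
  nth (letter0 A G) (map pull_letter w) i = pull_letter (nth (letter0 A G) w i).
Proof.
have e : pull_letter (letter0 A G) = letter0 A G.
  by rewrite /map_letter /letter0 /=; congr mkletter; exact: cochain_ext.
have [iw|wi] := ltnP i (size w); first exact: nth_map.
by rewrite !nth_default ?size_map // e.
Qed.

Lemma pull_sign (w : word C) : word_sign (map pull_letter w) = word_sign w.
Proof. by apply: word_sign_map; rewrite -map_comp. Qed.

Lemma pull_letter_d (l : letter C) : letter_d (pull_letter l) = pull_letter (letter_d l).
Proof. by rewrite /map_letter /letter_d /= -pull_cochain_d. Qed.

Lemma pull_letter_cup (l l' : letter C) :
  letter_cup (pull_letter l) (pull_letter l') = pull_letter (letter_cup l l').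
Proof. by rewrite /map_letter /letter_cup /= -pull_cochain_cup. Qed.

Lemma pull_bar_d x : pull_bar (bar_d x) = bar_d (pull_bar x).
Proof.
move: x; apply: tensor_ext.
- by move=> a x y; rewrite bar_d_linear pull_bar_linear.
- by move=> a x y; rewrite pull_bar_linear bar_d_linear.
move=> w; rewrite -/(bar_word w) pull_barE !bar_d_wordE /bar_d_word.
rewrite (linearD pull_bar); congr (_ + _).
- rewrite /bar_d1_word (linearN pull_bar) (linear_sum pull_bar) size_map.
  congr (- _); apply: eq_bigr => i _; rewrite (linearZ_LR pull_bar) /= pull_barE map_cat /=.
  by rewrite map_take map_drop -!map_take pull_sign pull_nth pull_letter_d.
- rewrite /bar_d2_word (linearN pull_bar) (linear_sum pull_bar) size_map.
  congr (- _); apply: eq_bigr => i _; rewrite (linearZ_LR pull_bar) /= pull_barE map_cat /=.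
  by rewrite map_take map_drop -!map_take pull_sign !pull_nth pull_letter_cup.
Qed.

Lemma pull_bar_deg m x : x \in @bar_deg A G m -> pull_bar x \in @bar_deg A G m.
Proof.
apply: tmap_span => [n|w]; first exact: pull_cochain_linear.
by rewrite /word_deg big_map.
Qed.

Lemma pull_bar_wt m x : x \in @bar_wt A G m -> pull_bar x \in @bar_wt A G m.
Proof.
apply: tmap_span => [n|w]; first exact: pull_cochain_linear.
by rewrite size_map.
Qed.

Lemma pull_wss_cycle r n x : x \in @wss_cycle A G r n -> pull_bar x \in @wss_cycle A G r n.
Proof.
move=> /and3P[x1 x2 x3]; apply/and3P; rewrite -pull_bar_d.
by split; [exact: pull_bar_deg | exact: pull_bar_wt | exact: pull_bar_wt].
Qed.

Lemma pull_symbol t : symbol (pull_talg t) = pull_bar (symbol t).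
Proof.
move: t; apply: tensor_ext.
- by move=> a x y; rewrite pull_talg_linear symbol_linear.
- by move=> a x y; rewrite symbol_linear pull_bar_linear.
move=> w; rewrite /symbol /pull_talg.
rewrite tmap_pure; last by move=> ?; exact: pull_H1_linear.
rewrite !tmap_pure; try by move=> ?; exact: H1_cochain_linear.
rewrite pull_barE -!map_comp.
congr tpure; apply: eq_map => l /=.
by rewrite /map_letter /= pull_H1_cochain.
Qed.

Lemma pull_massey_vanish n t :
  t \in @massey_vanish A G n -> pull_talg t \in @massey_vanish A G n.
Proof.
move=> /andP[t1 /asboolP t2]; apply/andP; split.
  move: t1; apply: tmap_span => [_|w]; first exact: pull_H1_linear.
  by rewrite size_map.
apply/asboolP => r /t2[x [y [x1 x2 y1 y2]]].
exists (pull_bar x), (pull_bar y); split; try exact: pull_wss_cycle.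
  by rewrite pull_symbol -(linearB (pull_bar)); exact: pull_bar_wt.
by rewrite -!pull_bar_d -(linearB (pull_bar)); exact: pull_bar_wt.
Qed.

Definition pull_massey n (t : massey_kernel A G n) : massey_kernel A G n :=
  MkMassey (pull_massey_vanish (mvalP t)).

End PullbackBar.

(** The map [K_(k+1) -> H] attached to [f] by [lead T |-> T - f^* T]. *)
Definition is_johnson_hom (A : comNzRingType) (G : groupType) (k : nat)
    (f : group_aut G) (tau : {linear massey_kernel A G k.+1 -> H1 A G}) : Prop :=
  forall (x : Bar A G) (t : massey_kernel A G k.+1),
    x \in @H0_Bar_le A G k.+1 -> is_lead k.+1 x t ->
    bar_H1 (tau t) = x - pull_bar f x.

(* Main.v *)
(** A zero-cocycle [x] of [Bar] is the same as a linear form on [A[G]] of finite rank: write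
    [F_x(g_1, .., g_p)] for the value of the weight [p] component of [x] at the point
    [(g_1, .., g_p)]. Evaluating [d x = 0] at simplices gives
      [F(.., g h, ..) = F(.., g, ..) + F(.., h, ..) + F(.., g, h, ..)],
    which says that [F_x(g_1, .., g_p) = phi_x((g_1 - 1) .. (g_p - 1))] for a linear form
    [phi_x] on [A[G]]; if [x] has weight at most [n], then [phi_x] kills [I^(n+1)]. Since [A]
    is a PID, evaluation at points is faithful on tensors of cochains (any finite set of
    functions lies in a finite rank split submodule, with a splitting by combinations of
    evaluations), so [phi_x] determines [x].

    For [f] in [J(k)] and [x] of weight at most [k+1], [phi_x - phi_x \o f] kills [1] and
    [I^2], because [f (a b) - a b] lies in [I^(k+2)] for [a], [b] in [I]; hence [x - f^* x]
    lies in [H]. It vanishes when [x] has weight at most [k], so it depends on the leading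
    term of [x] only. If [G] is finitely generated, then every form killing [I^(k+2)] is some
    [phi_x], and if moreover [A[G]/I^(k+2)] is torsion-free, then it is free of finite rank,
    so that these forms separate its points. *)
Require Import Defs.
From HB Require Import structures.
From mathcomp Require Import all_boot all_order all_algebra finmap.
From mathcomp Require Import boolp functions.
From mathcomp.multinomials Require Import monalg.
From mathcomp Require Import ring.

Set Implicit Arguments.
Unset Strict Implicit.
Unset Printing Implicit Defensive.

Import Order.TTheory GRing.Theory Num.Theory.
Local Open Scope ring_scope.

(** * Splitting finite families over a PID *)

Section LocalSplitting.
Variables (A : idomainType) (V : lmodType A) (X : Type) (e : X -> V -> A^o).

Definition comb (l : seq (A * X)) (v : V) : A^o := \sum_(p <- l) p.1 *: e p.2 v.

Hypothesis e_linear : forall x, linear (e x).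

Lemma comb_linear l : linear (comb l).
Proof.
move=> a v w; rewrite /comb scaler_sumr -big_split; apply: eq_bigr => p _ /=.
by rewrite e_linear scalerDr !scalerA mulrC.
Qed.

Hypothesis A_PID : is_PID A.

(** The values at [v] of all combinations of the [e x] form an ideal; a generator of it is itself
    the value of some [comb l]. *)
Lemma pid_comb_gen (v : V) :
  exists l, forall x, exists b, e x v = b * comb l v.
Proof.
have [||a _ [l ->]|d dP] := A_PID (J := fun y => exists l, y = comb l v).
- by exists [::]; rewrite /comb big_nil.
- by move=> _ _ [l ->] [l' ->]; exists (l ++ l'); rewrite /comb big_cat.
- exists [seq (a * p.1, p.2) | p <- l].
  by rewrite /comb big_map mulr_sumr; apply: eq_bigr => p _; rewrite -scalerA.
have [l dE] : exists l, d = comb l v by apply/dP; exists 1; rewrite mul1r.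
exists l => x; rewrite -dE; apply/dP; exists [:: (1, x)].
by rewrite /comb big_seq1 scale1r.
Qed.

(* For [d = 0] this says that the functionals [e x] separate the elements of [V]. *)
Hypothesis e_div : forall v d, (forall x, exists b, e x v = b * d) ->
  exists v', v = d *: v'.

(* Write the first vector as [comb l v *: g] with [l] such that [comb l v] generates
   the ideal of its values, and subtract [comb l w *: g] from each other vector [w]. *)
Lemma pid_split (s : seq V) : exists D : seq (V * seq (A * X)),
  forall v, v \in s -> v = \sum_(p <- D) comb p.2 v *: p.1.
Proof.
have [n] := ubnP (size s); elim: n s => // n IH [|v s] /= sn; first by exists [::].
have [l /e_div[g vE]] := pid_comb_gen v.
have [|D DP] := IH [seq w - comb l w *: g | w <- s]; first by rewrite size_map.
exists ((g - \sum_(p <- D) comb p.2 g *: p.1, l) :: D) => w.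
have cB p : comb p w - comb l w *: comb p g = comb p (w - comb l w *: g).
  by have := comb_linear p (- comb l w) g w; rewrite !scaleNr ![- _ + _]addrC => ->.
(* The expansion of [w] is that of [w - comb l w *: g] over [D] plus a multiple of [g]; moving the
   terms in [g] into the new vector lets every coefficient be taken at [w]. For [w = v] the
   difference is zero. *)
have aux : \sum_(p <- D) comb p.2 (w - comb l w *: g) *: p.1 = w - comb l w *: g ->
    w = comb l w *: (g - \sum_(p <- D) comb p.2 g *: p.1) + \sum_(p <- D) comb p.2 w *: p.1.
  move=> H; rewrite scalerBr addrAC -addrA -[LHS](subrKC (comb l w *: g)) -H; congr (_ + _).
  rewrite scaler_sumr -sumrB; apply: eq_bigr => p _.
  by rewrite -cB scalerBl scalerA.
rewrite inE big_cons /= => wvs; apply: aux; case/predU1P: wvs => [->|ws].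
  rewrite -vE subrr big1 // => p _.
  have := comb_linear p.2 (-1) 0 0.
  by rewrite scaler0 addr0 scaleN1r addNr => ->; rewrite scale0r.
by rewrite -DP //; apply: map_f.
Qed.

End LocalSplitting.

(** * Evaluation of tensors at points *)

Section LinearForms.
Variables (A : comNzRingType) (M : lmodType A) (f : M -> A).
Hypothesis f_linear : linear (f : M -> A^o).

Let f' : {linear M -> A^o} :=
  HB.pack (f : M -> A^o) (GRing.isLinear.Build _ _ _ _ (f : M -> A^o) f_linear).

Lemma linform0 : f 0 = 0. Proof. exact: (linear0 f'). Qed.
Lemma linformD x y : f (x + y) = f x + f y. Proof. exact: (linearD f'). Qed.
Lemma linformN x : f (- x) = - f x. Proof. exact: (linearN f'). Qed.
Lemma linformB x y : f (x - y) = f x - f y. Proof. exact: (linearB f'). Qed.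
Lemma linformZ a x : f (a *: x) = a * f x. Proof. exact: (linearZ_LR f'). Qed.

Lemma linform_sum (T : Type) (r : seq T) (P : pred T) (F : T -> M) :
  f (\sum_(i <- r | P i) F i) = \sum_(i <- r | P i) f (F i).
Proof. exact: (linear_sum f'). Qed.

End LinearForms.

Section TensorEvaluation.
Variables (A : comNzRingType) (I : choiceType) (V : I -> lmodType A).
Variables (X : Type) (e : X -> letter V -> A).
Implicit Types (q : seq X) (w : word V) (l : letter V) (t : tensor V).

Hypothesis e_linear : forall x i, linear (fun v : V i => e x (mkletter v) : A^o).

Fixpoint ev_word q w : A :=
  match q, w with
  | [::], [::] => 1
  | x :: q', l :: w' => e x l * ev_word q' w'
  | _, _ => 0
  end.

Lemma ev_word_multilinear q : multilinear (ev_word q : word V -> A^o).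
Proof.
elim: q => [|x q IH] [|l u] w i a v v' /=; rewrite ?scaler0 ?addr0 //.
  by rewrite e_linear mulrDl scalerAl.
by rewrite IH mulrDr scalerAr.
Qed.

Lemma ev_word_size q w : size w != size q -> ev_word q w = 0.
Proof.
by elim: q w => [|x q IH] [|l w] //= wq; rewrite IH ?mulr0.
Qed.

Definition tev q : tensor V -> A := tlift (ev_word q : word V -> A^o).

Lemma tev_linear q : linear (tev q : tensor V -> A^o).
Proof. exact/tlift_linear/ev_word_multilinear. Qed.
Lemma tev_pure q w : tev q (tpure w) = ev_word q w.
Proof. exact: (tlift_pure (ev_word_multilinear q)). Qed.

Definition tcons l : tensor V -> tensor V :=
  tlift (fun w => tpure (l :: w : word V)).

Lemma tcons_multilinear l : multilinear (fun w => tpure (l :: w : word V)).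
Proof. by move=> u w i a v v'; rewrite -!cat_cons tpure_multilinear. Qed.

Lemma tcons_linear l : linear (tcons l).
Proof. exact/tlift_linear/tcons_multilinear. Qed.
HB.instance Definition _ l :=
  GRing.isLinear.Build A (tensor V) (tensor V) *:%R (tcons l) (tcons_linear l).

Lemma tcons_pure l w : tcons l (tpure w) = tpure (l :: w : word V).
Proof. exact/tlift_pure/tcons_multilinear. Qed.

(** Contraction of the first tensor factor with the functional [e x]; the empty word has no such
    factor and goes to zero. *)
Definition slice_word x w : tensor V :=
  if w is l :: w' then e x l *: tpure (w' : word V) else 0.

Lemma slice_word_multilinear x : multilinear (slice_word x).
Proof.
move=> [|l u] w i a v v' /=; first by rewrite e_linear scalerDl scalerA.
by rewrite tpure_multilinear scalerDr !scalerA mulrC.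
Qed.

Definition tslice x : tensor V -> tensor V := tlift (slice_word x).

Lemma tslice_linear x : linear (tslice x).
Proof. exact/tlift_linear/slice_word_multilinear. Qed.
HB.instance Definition _ x :=
  GRing.isLinear.Build A (tensor V) (tensor V) *:%R (tslice x) (tslice_linear x).

Lemma tslice_pure x w : tslice x (tpure w) = slice_word x w.
Proof. exact/tlift_pure/slice_word_multilinear. Qed.

Lemma tev_cons x q t : tev (x :: q) t = tev q (tslice x t).
Proof.
move: t; apply: (tensor_ext (M := A^o)); [exact: tev_linear| |].
  by move=> a t s; rewrite linearP tev_linear.
move=> [|l w]; rewrite tev_pure tslice_pure /= ?(linform0 (tev_linear q)) //.
by rewrite (linformZ (tev_linear q)) tev_pure.
Qed.

Lemma tev_tcons x q l t : tev (x :: q) (tcons l t) = e x l * tev q t.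
Proof.
move: t; apply: (tensor_ext (M := A^o)).
- by move=> a t s; rewrite linearP tev_linear.
- by move=> a t s; rewrite tev_linear mulrDr scalerAr.
by move=> w; rewrite tcons_pure !tev_pure.
Qed.

Lemma tev_nil_tcons l t : tev [::] (tcons l t) = 0.
Proof.
move: t; apply: (tensor_ext (M := A^o)); first by move=> a t s; rewrite linearP tev_linear.
  by move=> a t s; rewrite scaler0 addr0.
by move=> w; rewrite tcons_pure tev_pure.
Qed.

Lemma tspan_ind (P : pred (word V)) (M : lmodType A) (f g : tensor V -> M) :
  linear f -> linear g -> (forall w, P w -> f (tpure w) = g (tpure w)) ->
  forall t, t \in tspan P -> f t = g t.
Proof.
move=> fL gL fg t /asboolP[x xP ->].
pose f' : {linear tensor V -> M} := HB.pack f (GRing.isLinear.Build _ _ _ _ f fL).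
pose g' : {linear tensor V -> M} := HB.pack g (GRing.isLinear.Build _ _ _ _ g gL).
rewrite [x]malg_gen /mlin -[f]/(f' : _ -> _) -[g]/(g' : _ -> _) !linear_sum.
rewrite !big_seq; apply: eq_bigr => w /xP wP; rewrite !linearZ /=; congr (_ *: _).
exact: fg.
Qed.

Lemma tev_size_span (P : pred (word V)) q t : t \in tspan P ->
  (forall w, P w -> size w != size q) -> tev q t = 0.
Proof.
move=> tP Pq; apply: (tspan_ind (M := A^o) (g := fun=> 0)) tP; first exact: tev_linear.
  by move=> a u v; rewrite scaler0 addr0.
by move=> w /Pq wq; rewrite tev_pure ev_word_size.
Qed.

(** Finitely many letters expand over a finite family, with combinations of evaluations as
    coordinates. It is stated for words headed by the letter because letters with different tags
    cannot be added. *)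
Hypothesis e_split : forall L : seq (letter V),
  exists D : seq (letter V * seq (A * X)), forall l, l \in L -> forall w,
    tpure (l :: w : word V) =
    \sum_(p <- D) (\sum_(b <- p.2) b.1 * e b.2 l) *: tpure (p.1 :: w : word V).

Lemma tensor_fullspan t : exists n, t \in tspan (fun w : word V => (size w < n)%N).
Proof.
rewrite -[t]treprK; exists (\max_(w <- msupp (trepr t)) size w).+1.
apply/asboolP; exists (trepr t) => // w wt; rewrite unfold_in ltnS.
exact: leq_bigmax_seq.
Qed.

(** Induction on the length of words: by [e_split], [t] is recovered linearly from its value at the
    empty tuple and from its slices, which are shorter and have zero evaluations. *)
Lemma tev_inj0 t : (forall q, tev q t = 0) -> t = 0.
Proof.
have [n] := tensor_fullspan t; elim: n t => [|n IH] t.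
  move=> tn _; apply: (tspan_ind (f := id) (g := fun=> 0)) tn => // a u v.
  by rewrite scaler0 addr0.
move=> tn t0; have /asboolP[x _ tE] := tn.
have [D DP] := e_split (pmap ohead (msupp x : seq (word V))).
have sl0 y : tslice y t = 0.
  apply: IH => [|q]; last by rewrite -tev_cons.
  apply: (tspan_lift (slice_word_multilinear y)) (tn) => -[|l w] wn; first exact: rpred0.
  by rewrite rpredZ //; apply: tpure_span.
(* [g] is this reconstruction. It has to agree with the identity only on the words supporting [x],
   whose first letters were given to [e_split]. *)
pose g u := (tev [::] u : A) *: tpure ([::] : word V) + \sum_(p <- D)
    tcons p.1 (\sum_(b <- p.2) b.1 *: tslice b.2 u).
have -> : t = g t.
  apply: (tspan_ind (P := fun w => w \in msupp x) (f := id)).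
  - by [].
  - move=> a u v; rewrite /g.
    have -> : tev [::] (a *: u + v) = a * tev [::] u + tev [::] v :> A.
      exact: tev_linear.
    rewrite scalerDl -scalerA [in RHS]scalerDr [RHS]addrACA.
    congr (_ + _); rewrite scaler_sumr -big_split; apply: eq_bigr => p _ /=.
    rewrite -linearP; congr (tcons _ _); rewrite scaler_sumr -big_split.
    by apply: eq_bigr => b _; rewrite linearP scalerDr !scalerA mulrC.
  - move=> [|l w] wx; rewrite /g tev_pure /=.
      rewrite scale1r big1 ?addr0 // => p _; rewrite big1 ?linear0 // => b _.
      by rewrite tslice_pure scaler0.
    have lx : l \in pmap ohead (msupp x : seq (word V)).
      by rewrite mem_pmap; apply/mapP; exists (l :: w).
    rewrite scale0r add0r {1}(DP _ lx); apply: eq_bigr => p _.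
    rewrite -tcons_pure -linearZ scaler_suml; congr (tcons _ _).
    by apply: eq_bigr => b _; rewrite tslice_pure scalerA.
  - by rewrite tE; apply/asboolP; exists x.
rewrite /g t0 scale0r add0r big1 // => p _; rewrite big1 ?linear0 // => b _.
by rewrite sl0 scaler0.
Qed.

End TensorEvaluation.

Section LetterSplitting.
Variables (A : idomainType) (I : choiceType) (V : I -> lmodType A).

Lemma tpure_cons_sum i (v : V i) (T : Type) (D : seq T) (c : T -> A) (g : T -> V i)
    (w : word V) : v = \sum_(p <- D) c p *: g p ->
  tpure (mkletter v :: w : word V)
  = \sum_(p <- D) c p *: tpure (mkletter (g p) :: w : word V).
Proof.
pose f (u : V i) := tpure (mkletter u :: w : word V).
have f_lin : linear f by move=> a u u'; exact: (tpure_multilinear [::]).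
pose f' : {linear V i -> tensor V} := HB.pack f (GRing.isLinear.Build _ _ _ _ f f_lin).
move=> ->; rewrite -[LHS]/(f' _) linear_sum; apply: eq_bigr => p _.
exact: linearZ.
Qed.

Lemma letters_of_tag (L : seq (letter V)) i :
  exists s : seq (V i), forall v : V i, mkletter v \in L -> v \in s.
Proof.
elim: L => [|[j u] L [s sP]]; first by exists [::].
have [ji|ji] := eqVneq j i.
  subst j; exists (u :: s) => v; rewrite !inE => /orP[|/sP ->]; last by rewrite orbT.
  by rewrite -[existT _ _ _]/(mkletter u) eq_Tagged /= => ->.
exists s => v; rewrite inE => /predU1P[e|/sP //].
by have /= ij := congr1 tag e; rewrite -ij eqxx in ji.
Qed.

End LetterSplitting.

(** * Evaluation of cochains and of the bar differential *)

Section Points.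
Variables (A : idomainType) (G : groupType).
Local Notation C := (cochain A G).
Local Notation H := (fun _ : unit => H1 A G).

(** A simplex [[g_1 | .. | g_n]] is encoded by the list of its entries; it evaluates
    cochains of other degrees to zero. *)
Definition ev_simplex (s : seq G) (l : letter C) : A :=
  if tag l == size s then cval (tagged l) (fun i => nth 1%g s i) else 0.

Definition ev_H1 (x : G) (l : letter H) : A := hval (tagged l) x.

Lemma ev_simplex_linear s n :
  linear (fun c : C n => ev_simplex s (mkletter c) : A^o).
Proof.
by move=> a c c'; rewrite /ev_simplex /=; case: ifP => // _; rewrite scaler0 addr0.
Qed.

Lemma ev_H1_linear x i : linear (fun h : H i => ev_H1 x (mkletter (V := H) (i := i) h) : A^o).
Proof. by []. Qed.

Definition simplex_seq n (s : simplex G n) : seq G := [seq s i | i <- enum 'I_n].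

Lemma size_simplex_seq n (s : simplex G n) : size (simplex_seq s) = n.
Proof. by rewrite size_map size_enum_ord. Qed.

Lemma ev_simplex_seq n (s : simplex G n) (c : C n) :
  ev_simplex (simplex_seq s) (mkletter c) = c s.
Proof.
rewrite /ev_simplex /= size_simplex_seq eqxx; congr (cval c _).
apply: funext => i; rewrite (nth_map i) ?size_enum_ord //.
by rewrite nth_ord_enum.
Qed.

(** The value [0] is chosen for [q x] wherever [f x] is zero, even if [d = 0]; thus a quotient of a
    reduced cochain is again reduced. *)
Lemma choose_quotient (X : Type) (f : X -> A) (d : A) :
  (forall x, exists b, f x = b * d) ->
  exists q : X -> A, forall x, f x = d * q x /\ (f x = 0 -> q x = 0).
Proof.
move=> fd; suff /choice[q qE] x : exists b, f x = d * b /\ (f x = 0 -> b = 0).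
  by exists q.
have [fx0|fx0] := pselect (f x = 0).
  by exists 0; rewrite fx0 mulr0.
by have [b fE] := fd x; exists b; split=> //; rewrite fE mulrC.
Qed.

Lemma cochain_div n (c : C n) (d : A) :
  (forall s, exists b, c s = b * d) -> exists c' : C n, c = d *: c'.
Proof.
move=> /choose_quotient[q qE]; have /asboolP[c0 c1] := cval_reduced c.
have red : (q : simplex G n -> A^o) \in @reduced A G n.
  by apply/asboolP; split=> [s ds|]; apply: (qE _).2 => //; exact: c0.
by exists (MkCochain red); apply: cochain_ext => s; exact: (qE s).1.
Qed.

Lemma H1_div (h : H1 A G) (d : A) :
  (forall x, exists b, h x = b * d) -> exists h' : H1 A G, h = d *: h'.
Proof.
(* For [d = 0] the quotient is taken to be [0]; otherwise its additivity follows by cancelling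
   [d]. *)
have [->|d0] := eqVneq d 0.
  move=> h0; exists 0; rewrite scaler0; apply: H1_ext => x.
  by have [b ->] := h0 x; rewrite mulr0.
move=> /choose_quotient[q qE]; have /asboolP hM := hval_hom h.
have hom : (q : G -> A^o) \in @is_hom A G.
  by apply/asboolP => x y; apply: (mulfI d0); rewrite mulrDr -!(qE _).1 hM.
by exists (MkH1 hom); apply: H1_ext => x; exact: (qE x).1.
Qed.

Hypothesis A_PID : is_PID A.

Lemma H1_split (s : seq (H1 A G)) : exists D : seq (H1 A G * seq (A * G)),
  forall h, h \in s ->
    h = \sum_(p <- D) (\sum_(b <- p.2) b.1 * h b.2) *: p.1.
Proof.
have [] := @pid_split A (H1 A G) G (fun x h => hval h x) _ A_PID _ s.
- by [].
- by move=> h d; exact: H1_div.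
by move=> D DP; exists D.
Qed.

Lemma letter_H1_split (L : seq (letter H)) :
  exists D : seq (letter H * seq (A * G)), forall l, l \in L -> forall w,
    tpure (l :: w : word H) =
    \sum_(p <- D) (\sum_(b <- p.2) b.1 * ev_H1 b.2 l) *: tpure (p.1 :: w : word H).
Proof.
have [s sP] := letters_of_tag L tt; have [D DP] := H1_split s.
exists [seq (mkletter (V := H) (i := tt) p.1, p.2) | p <- D] => -[[] h] /sP /DP hE w.
by rewrite big_map -(tpure_cons_sum w hE).
Qed.

Lemma cochain_split n (s : seq (C n)) : exists D : seq (C n * seq (A * simplex G n)),
  forall c, c \in s ->
    c = \sum_(p <- D) (\sum_(b <- p.2) b.1 * c b.2) *: p.1.
Proof.
have [] := @pid_split A (C n) (simplex G n) (fun x c => cval c x) _ A_PID _ s.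
- by [].
- by move=> h d; exact: cochain_div.
by move=> D DP; exists D.
Qed.

Lemma letter_cochain_split (L : seq (letter C)) :
  exists D : seq (letter C * seq (A * seq G)), forall l, l \in L -> forall w,
    tpure (l :: w : word C) =
    \sum_(p <- D) (\sum_(b <- p.2) b.1 * ev_simplex b.2 l) *: tpure (p.1 :: w : word C).
Proof.
(* Each degree is split separately. Evaluations at [n]-simplices kill letters of every other degree,
   so the families for the finitely many degrees in [L] can be concatenated. *)
have /choice[D DP] n : exists D : seq (letter C * seq (A * seq G)),
    (forall l p, tag l != n -> p \in D -> \sum_(b <- p.2) b.1 * ev_simplex b.2 l = 0)
  /\ forall l, l \in L -> tag l = n -> forall w, tpure (l :: w : word C) =
    \sum_(p <- D) (\sum_(b <- p.2) b.1 * ev_simplex b.2 l) *: tpure (p.1 :: w : word C).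
  have [s sP] := letters_of_tag L n; have [D DP] := cochain_split s.
  exists [seq (mkletter p.1, [seq (b.1, simplex_seq b.2) | b <- p.2]) | p <- D].
  split=> [l _ ln /mapP[p _ ->]|[m c] + /= mn w].
    rewrite big_map big1 // => b _.
    by rewrite /ev_simplex size_simplex_seq (negPf ln) mulr0.
  subst m => /sP /DP cE; rewrite big_map (tpure_cons_sum w cE).
  apply: eq_bigr => p _; congr (_ *: _); rewrite big_map; apply: eq_bigr => b _.
  by rewrite [existT _ _ _]/(mkletter c) ev_simplex_seq.
exists (flatten [seq D n | n <- undup [seq tag l | l <- L]]) => l lL w.
rewrite big_flatten big_map (bigD1_seq (tag l)) /= ?undup_uniq //; last first.
  by rewrite mem_undup map_f.
rewrite [X in _ + X]big1 ?addr0; first exact: (DP (tag l)).2.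
move=> n ln; rewrite big1_seq // => p /andP[_ pD].
by rewrite (DP n).1 ?scale0r // eq_sym.
Qed.

Definition bev (q : seq (seq G)) : Bar A G -> A := tev ev_simplex q.

Lemma bev_linear q : linear (bev q : Bar A G -> A^o).
Proof. exact/tev_linear/ev_simplex_linear. Qed.

Definition hev (u : seq G) : talg (H1 A G) -> A := tev ev_H1 u.

Lemma hev_linear u : linear (hev u : talg (H1 A G) -> A^o).
Proof. exact/tev_linear/ev_H1_linear. Qed.

Lemma bev_inj (x y : Bar A G) : (forall q, bev q x = bev q y) -> x = y.
Proof.
move=> xy; apply/eqP; rewrite -subr_eq0; apply/eqP.
apply: (tev_inj0 ev_simplex_linear letter_cochain_split) => q.
by rewrite -/(bev q _) (linformB (bev_linear q)) xy subrr.
Qed.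

Lemma hev_inj (t s : talg (H1 A G)) : (forall u, hev u t = hev u s) -> t = s.
Proof.
move=> ts; apply/eqP; rewrite -subr_eq0; apply/eqP.
apply: (tev_inj0 ev_H1_linear letter_H1_split) => u.
by rewrite -/(hev u _) (linformB (hev_linear u)) ts subrr.
Qed.

End Points.

(** * Cocycles of degree zero as functions on tuples of group elements *)

Section DegreeZero.
Variables (A : idomainType) (G : groupType).
Local Notation C := (cochain A G).
Local Notation Bar := (Bar A G).
Local Notation bword := (word C).
Local Notation ones := (map (fun g : G => [:: g])).
Local Notation evw := (ev_word (@ev_simplex A G)).

(** Evaluation at a tuple of [1]-simplices: [bev0 u x] is the value [F_x(u)]. *)
Definition bev0 (u : seq G) : Bar -> A := bev (ones u).

Lemma bev0_linear u : linear (bev0 u : Bar -> A^o).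
Proof. exact: bev_linear. Qed.

Lemma bev_word q (w : bword) : bev q (bar_word w) = evw q w.
Proof. exact/tev_pure/ev_simplex_linear. Qed.

Lemma bev_cons s q (x : Bar) : bev (s :: q) x = bev q (tslice (@ev_simplex A G) s x).
Proof. exact/tev_cons/ev_simplex_linear. Qed.

Definition cochain_word (n : nat) (w : bword) := all (fun l => tag l == n) w.

(** A word of degree [0] either has only letters of degree [1] or contains a cochain of degree [0];
    words of the second kind vanish because reduced [0]-cochains are zero. *)
Lemma bar_deg0_ind (M : lmodType A) (f g : Bar -> M) : linear f -> linear g ->
  (forall w, cochain_word 1 w -> f (bar_word w) = g (bar_word w)) ->
  forall x, x \in @bar_deg A G 0 -> f x = g x.
Proof.
move=> fL gL fg x; apply: tspan_ind => // w /eqP wdeg.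
have [|/hasPn w0] := boolP (has (fun l => tag l == 0%N) w); last first.
  apply: fg; apply/allP => l lw.
  move: wdeg; rewrite /word_deg big_seq => /eqP.
  rewrite psumr_eq0 => [/allP/(_ l lw)|m /w0]; rewrite ?lw /=.
    by rewrite subr_eq0.
  by rewrite subr_ge0 lez_nat lt0n.
case/hasP=> -[n c] lw /= /eqP n0; move: n0 c lw => -> c /[!(cochain0 c)].
case/splitPr=> u w'.
rewrite [tpure _](multilinear0 (@tpure_multilinear _ _ C)).
have lin0 (h : Bar -> M) : linear h -> h 0 = 0.
  by move=> hL; have := hL (-1) 0 0; rewrite scaler0 addr0 scaleN1r addNr.
by rewrite !lin0.
Qed.

Lemma evw1_nil s q (l : letter C) w : tag l = 1%N -> size s != 1%N ->
  evw (s :: q) (l :: w) = 0.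
Proof. by move=> l1 s1; rewrite /= /ev_simplex ifN ?mul0r // l1 eq_sym. Qed.

Lemma evw_ones q w : cochain_word 1 w -> ~~ all (fun s => size s == 1%N) q -> evw q w = 0.
Proof.
elim: q w => [|s q IH] [|l w] //= /andP[/eqP l1 w1].
rewrite negb_and => /orP[s1|/(IH _ w1) ->]; last by rewrite mulr0.
exact: (@evw1_nil s q l w).
Qed.

Lemma ones_flatten (q : seq (seq G)) : all (fun s => size s == 1%N) q ->
  q = ones (flatten q).
Proof. by elim: q => //= -[|g [|h s]] q IH //= /IH {1}->. Qed.

Lemma bev_deg0 q (x : Bar) : x \in @bar_deg A G 0 ->
  ~~ all (fun s => size s == 1%N) q -> bev q x = 0.
Proof.
move=> x0 q1; apply: (bar_deg0_ind (M := A^o) (g := fun=> 0)) x0; first exact: bev_linear.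
  by move=> a y z; rewrite scaler0 addr0.
by move=> w w1; rewrite bev_word evw_ones.
Qed.

Hypothesis A_PID : is_PID A.

Lemma bev0_inj (x y : Bar) : x \in @bar_deg A G 0 -> y \in @bar_deg A G 0 ->
  (forall u, bev0 u x = bev0 u y) -> x = y.
Proof.
move=> x0 y0 xy; apply: (bev_inj A_PID) => q.
have [/ones_flatten ->|q1] := boolP (all (fun s => size s == 1%N) q); first exact: xy.
by rewrite !bev_deg0.
Qed.

(** The transpose of the bar differential. *)
Fixpoint bdry (q : seq (seq G)) (F : seq G -> A) : A :=
  match q with
  | [:: g] :: q' => bdry q' (fun u => F (g :: u))
  | [:: g; h] :: q' =>
      let v := flatten q' in
      if all (fun s => size s == 1%N) q' then
        F ((g * h)%g :: v) - F (g :: v) - F (h :: v) - F [:: g, h & v]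
      else 0
  | _ => 0
  end.

Lemma bdry_linear q a F F' :
  bdry q (fun u => a * F u + F' u) = a * bdry q F + bdry q F'.
Proof.
elim: q F F' => [|[|g [|h [|k s]]] q IH] F F' /=; rewrite ?mulr0 ?addr0 //.
case: ifP => _; rewrite ?mulr0 ?addr0 //; ring.
Qed.

(** A letter of cochain degree [1] contributes the exponent [2] to [word_sign], so prefixing it
    leaves the signs of the remaining terms unchanged. *)
Lemma bar_d_cons (c : C 1) (w : bword) :
  bar_d (bar_word (mkletter c :: w)) =
    - bar_word (mkletter (cochain_d c) :: w)
    - (if w is l :: w' then bar_word (letter_cup (mkletter c) l :: w') else 0)
    + tcons (mkletter c) (bar_d (bar_word w)).
Proof.
have sgn u : word_sign (mkletter c :: u : bword) = word_sign u.
  by rewrite /word_sign big_cons exprD /= sqrrN expr1n mul1r.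
rewrite !bar_d_wordE /bar_d_word linearD /=.
have -> : bar_d1_word (mkletter c :: w) =
    - bar_word (mkletter (cochain_d c) :: w) + tcons (mkletter c) (bar_d1_word w).
  rewrite /bar_d1_word /= big_ord_recl /= opprD /word_sign big_nil expr0 scale1r.
  rewrite drop0; congr (_ + _); rewrite (linearN (tcons _)) (linear_sum (tcons _)); congr (- _).
  apply: eq_bigr => i _; rewrite (linearZ_LR (tcons _)) /= tcons_pure -!/(word_sign _).
  by rewrite -/(word_sign _) sgn.
have -> : bar_d2_word (mkletter c :: w) =
    - (if w is l :: w' then bar_word (letter_cup (mkletter c) l :: w') else 0)
    + tcons (mkletter c) (bar_d2_word w).
  rewrite /bar_d2_word; case: w => [|l w] /=.
    by rewrite !big_ord0 !oppr0 linear0 addr0.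
  rewrite big_ord_recl /= opprD sgn /word_sign big_nil expr0 scale1r.
  rewrite drop0; congr (_ + _); rewrite (linearN (tcons _)) (linear_sum (tcons _)); congr (- _).
  apply: eq_bigr => i _; rewrite (linearZ_LR (tcons _)) /= tcons_pure -!/(word_sign _).
  by rewrite -/(word_sign _) sgn.
by rewrite addrACA.
Qed.

Lemma cochain_word_cons (l : letter C) w : cochain_word 1 (l :: w) ->
  exists2 c : C 1, l = mkletter c & cochain_word 1 w.
Proof.
by case: l => n c /= /andP[/eqP /= n1 w1]; subst n; exists c.
Qed.

Lemma ev_simplex1 g (c : C 1) : ev_simplex [:: g] (mkletter c) = c (fun=> g).
Proof.
by rewrite /ev_simplex /=; congr (cval c _); apply: funext => i; rewrite (ord1 i).
Qed.

Lemma ev_simplex_d g h (c : C 1) :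
  ev_simplex [:: g; h] (mkletter (cochain_d c))
  = ev_simplex [:: h] (mkletter c) - ev_simplex [:: (g * h)%g] (mkletter c)
    + ev_simplex [:: g] (mkletter c).
Proof.
rewrite !ev_simplex1 /ev_simplex /= /cobd !big_ord_recl big_ord0 addr0 /=.
rewrite expr0 mul1r expr1 mulN1r exprS expr1 mulN1r opprK mul1r addrA.
by congr (_ - _ + _); congr (cval c _); apply: funext => i; rewrite (ord1 i).
Qed.

Lemma ev_simplex_cup g h (c c' : C 1) :
  ev_simplex [:: g; h] (letter_cup (mkletter c) (mkletter c'))
  = ev_simplex [:: g] (mkletter c) * ev_simplex [:: h] (mkletter c').
Proof.
rewrite !ev_simplex1 /ev_simplex /= /cup.
by congr (cval c _ * cval c' _); apply: funext => i; rewrite (ord1 i).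
Qed.

Lemma bar_d_nil : bar_d (bar_word ([::] : bword)) = 0.
Proof.
rewrite bar_d_wordE /bar_d_word.
have -> : bar_d1_word ([::] : bword) = 0 by rewrite /bar_d1_word big_ord0 oppr0.
have -> : bar_d2_word ([::] : bword) = 0 by rewrite /bar_d2_word big_ord0 oppr0.
exact: addr0.
Qed.

Lemma bdry0 q F : F =1 (fun=> 0) -> bdry q F = 0.
Proof.
elim: q F => [|[|g [|h [|k s]]] q IH] F F0 //=; first exact: IH.
by rewrite !F0 !subr0 if_same.
Qed.

(** Induction on [w] along [bar_d_cons], by the size of the first simplex of [q]: a [1]-simplex sees
    only the last term of the recursion, a [2]-simplex only the coboundary and the cup product, and
    no other simplex sees anything. *)
Lemma bev_bar_d_word q (w : bword) : cochain_word 1 w ->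
  bev q (bar_d (bar_word w)) = bdry q (fun u => evw (ones u) w).
Proof.
elim: w q => [|l w IH] q.
  rewrite bar_d_nil (linform0 (bev_linear q)) => _; case: q => [|[|g [|h [|k s]]] q] //=.
    by rewrite bdry0.
  by rewrite !subr0 if_same.
case/cochain_word_cons=> c -> w1; rewrite bar_d_cons.
have bevD (x y z : Bar) : bev q (- x - y + z) = - bev q x - bev q y + bev q z :> A.
  by rewrite (linformD (bev_linear q)) (linformB (bev_linear q)) (linformN (bev_linear q)).
rewrite bevD {bevD}.
set cupw := match w with [::] => _ | _ => _ end.
have cupE s q' : bev (s :: q') cupw =
    if w is l :: w' then ev_simplex s (letter_cup (mkletter c) l) * evw q' w' else 0.
  by rewrite /cupw; case: (w) => [|l' w']; rewrite ?(linform0 (bev_linear _)) ?bev_word.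
have cup_nil : bev [::] cupw = 0.
  by rewrite /cupw; case: (w) => [|l' w']; rewrite ?(linform0 (bev_linear _)) ?bev_word.
have ev0 n s (c' : C n) : size s != n -> ev_simplex s (mkletter c') = 0.
  by move=> sn; rewrite /ev_simplex ifN // eq_sym.
have cup0 s q' : size s != 2%N -> bev (s :: q') cupw = 0.
  move=> s2; rewrite cupE; case: (w) w1 => [//|l' w'] /cochain_word_cons[c' -> _].
  by rewrite ev0 ?mul0r.
have evd s q' : bev (s :: q') (bar_word (mkletter (cochain_d c) :: w)) =
  ev_simplex s (mkletter (cochain_d c)) * evw q' w by rewrite bev_word.
case: q => [|s q].
  by rewrite bev_word cup_nil [bev _ _](tev_nil_tcons (@ev_simplex_linear A G)) oppr0 !addr0.
rewrite evd [X in _ + X](tev_tcons (@ev_simplex_linear A G)) -/(bev q _) IH //.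
case: s => [|g [|h [|k s]]] /=.
- by rewrite cup0 // !ev0 // !mul0r oppr0 !addr0.
- rewrite cup0 // ev0 // mul0r oppr0 !add0r.
  have := bdry_linear q (ev_simplex [:: g] (mkletter c)) (fun u => evw (ones u) w) (fun=> 0).
  rewrite (@bdry0 q (fun=> 0)) // addr0 => <-; congr bdry; apply: funext => u; exact: addr0.
- rewrite cupE ev_simplex_d [ev_simplex [:: g; h] (mkletter c)]ev0 // mul0r addr0.
  case: ifP => [/ones_flatten q1|/negbT q1].
    rewrite {1 2}q1; set v := flatten q.
    have -> : (if w is l :: w' then
        ev_simplex [:: g; h] (letter_cup (mkletter c) l) * evw (ones v) w' else 0)
      = ev_simplex [:: g] (mkletter c) * evw (ones (h :: v)) w.
      case: (w) w1 => [|l' w']; first by rewrite mulr0.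
      by case/cochain_word_cons=> c' -> _; rewrite ev_simplex_cup -mulrA.
    rewrite /=; ring.
  rewrite evw_ones // mulr0 oppr0 add0r.
  case: (w) w1 => [|l' w']; first by rewrite oppr0.
  by case/cochain_word_cons=> c' -> w1'; rewrite evw_ones // mulr0 oppr0.
- by rewrite cup0 // !ev0 // !mul0r oppr0 !addr0.
Qed.

Lemma bev_bar_d q (x : Bar) : x \in @bar_deg A G 0 ->
  bev q (bar_d x) = bdry q (fun u => bev0 u x).
Proof.
move: x; apply: (bar_deg0_ind (M := A^o)).
- by move=> a x y; rewrite (linearP (@bar_d A G)) bev_linear.
- move=> a x y; rewrite -[RHS]bdry_linear; congr bdry; apply: funext => u.
  exact: bev0_linear.
move=> w w1; rewrite bev_bar_d_word //; congr bdry; apply: funext => u.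
exact/esym/bev_word.
Qed.

(** This reflects the identity [gh - 1 = (g - 1) + (h - 1) + (g - 1)(h - 1)] for the values of a
    linear form on products of elements [g - 1]. *)
Definition cocycle_fun (F : seq G -> A) := forall u g h v,
  F (u ++ (g * h)%g :: v) = F (u ++ g :: v) + F (u ++ h :: v) + F (u ++ [:: g, h & v]).

Lemma bdry_ones u g h v F :
  bdry (ones u ++ [:: g; h] :: ones v) F =
    F (u ++ (g * h)%g :: v) - F (u ++ g :: v) - F (u ++ h :: v) - F (u ++ [:: g, h & v]).
Proof.
elim: u F => [|k u IH] F /=; last exact: IH.
have -> : all (fun s : seq G => size s == 1%N) (ones v) by elim: (v).
by have -> : flatten (ones v) = v by elim: (v) => //= a s ->.
Qed.

(** Evaluations separate [Bar], and [bdry] can be nonzero only at tuples of [1]-simplices with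
    exactly one [2]-simplex inserted, where it is the defect of the cocycle identity. *)
Lemma cocycle_bar_d (x : Bar) : x \in @bar_deg A G 0 ->
  cocycle_fun (fun u => bev0 u x) -> bar_d x = 0.
Proof.
move=> x0 Fx.
apply: (bev_inj A_PID) => q; rewrite (linform0 (bev_linear _)) bev_bar_d //.
move: (bev0^~ x) Fx => F; elim: q F => [|[|g [|h [|k s]]] q IH] F FF //=.
  by apply: IH => u h k v; apply: (FF (g :: u)).
case: ifP => // _; move: (FF [::] g h (flatten q)) => /= ->; ring.
Qed.

End DegreeZero.

(** * Powers of the augmentation ideal *)

Section GroupRingPowers.
Variables (A : comNzRingType) (G : groupType).
Local Notation AG := (group_ring A G).
Local Notation aug_pow := (ideal_pow (@aug_ideal A G)).
Implicit Types (x y z : AG) (u v : seq G).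

Definition gel (g : G) : AG := << g >>.

Lemma gelM g h : gel (g * h)%g = gel g * gel h.
Proof. exact/esym/gmulU. Qed.

Lemma gel1 : gel 1%g = 1. Proof. by []. Qed.

Lemma gr_linear_ext (M : lmodType A) (f f' : AG -> M) : linear f -> linear f' ->
  (forall g, f (gel g) = f' (gel g)) -> f =1 f'.
Proof.
move=> fL f'L ff'.
pose h : {linear AG -> M} := HB.pack f (GRing.isLinear.Build _ _ _ _ f fL).
pose h' : {linear AG -> M} := HB.pack f' (GRing.isLinear.Build _ _ _ _ f' f'L).
exact: (@malg_ext A G M h h').
Qed.

Lemma gr_mull_linear x : linear (fun y => x * y). Proof. exact: gmulPr. Qed.

Lemma gr_mulr_linear y : linear (fun x => x * y).
Proof. by move=> a x x'; exact: gmulPl. Qed.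

Lemma gr_scalerAl a x y : a *: x * y = a *: (x * y).
Proof. by have := gmulPl y a x 0; rewrite !addr0 [gmul 0 y](mul0r (y : AG)) addr0. Qed.

Lemma augmentation_linear : linear (@augmentation A G : AG -> A^o).
Proof. exact: mlin_is_linear. Qed.

Lemma augmentation_gel g : augmentation (gel g) = 1 :> A.
Proof. exact: (@mlinU A G A^o). Qed.

Lemma augmentationM x y : augmentation (x * y) = augmentation x * augmentation y.
Proof.
move: x; apply: (gr_linear_ext (M := A^o)).
- by move=> a x x'; rewrite gr_mulr_linear augmentation_linear.
- by move=> a x x'; rewrite augmentation_linear mulrDl scalerAl.
move=> g; move: y; apply: (gr_linear_ext (M := A^o)).
- by move=> a x x'; rewrite gr_mull_linear augmentation_linear.
- by move=> a x x'; rewrite augmentation_linear mulrDr scalerAr.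
by move=> h; rewrite -gelM !augmentation_gel mulr1.
Qed.

Lemma aug_pow0 n : aug_pow n 0.
Proof. by case: n => //= n; exists [::]; rewrite big_nil. Qed.

Lemma aug_pow_mull n x y : aug_pow n x -> aug_pow n (y * x).
Proof.
case: n => //= n [s [sI ->]]; exists [seq (y * p.1, p.2) | p <- s]; split.
  move=> _ /mapP[p /sI[p1 p2] ->] /=; split=> //.
  by rewrite /aug_ideal augmentationM p1 mulr0.
by rewrite mulr_sumr big_map; apply: eq_bigr => p _; rewrite mulrA.
Qed.

Lemma aug_pow_mulr n x y : aug_pow n x -> aug_pow n (x * y).
Proof.
elim: n x => //= n IH x [s [sI ->]]; exists [seq (p.1, p.2 * y) | p <- s]; split.
  by move=> _ /mapP[p /sI[p1 p2] ->] /=; split=> //; exact: IH.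
by rewrite mulr_suml big_map; apply: eq_bigr => p _; rewrite mulrA.
Qed.

Lemma aug_powZ n a x : aug_pow n x -> aug_pow n (a *: x).
Proof. by rewrite -[x in a *: x]mul1r -gr_scalerAl; exact: aug_pow_mull. Qed.

Lemma aug_pow_linear n a x y : aug_pow n x -> aug_pow n y -> aug_pow n (a *: x + y).
Proof. by move=> xn yn; apply: aug_powD => //; exact: aug_powZ. Qed.

Lemma aug_powS n x : aug_pow n.+1 x -> aug_pow n x.
Proof.
elim: n x => [//|n IH] x [s [sI ->]]; exists s; split=> // p /sI[p1 p2].
by split=> //; exact: IH.
Qed.

Lemma aug_pow_le m n x : (m <= n)%N -> aug_pow n x -> aug_pow m x.
Proof. by move=> /subnK <-; elim: (n - m)%N => [|k IH] // /aug_powS. Qed.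

Lemma aug_powMI n x y : aug_ideal x -> aug_pow n y -> aug_pow n.+1 (x * y).
Proof.
by move=> xI yn; exists [:: (x, y)]; rewrite big_seq1; split=> // p /[!inE] /eqP ->.
Qed.

Lemma aug_powIM n x y : aug_pow n x -> aug_ideal y -> aug_pow n.+1 (x * y).
Proof.
elim: n x => [|n IH] x xn yI.
  rewrite -[_ * y]mulr1; apply: aug_powMI => //.
  by rewrite /aug_ideal augmentationM yI mulr0.
case: xn => s [sI ->]; exists [seq (p.1, p.2 * y) | p <- s]; split.
  by move=> _ /mapP[p /sI[p1 p2] ->]; split=> //; exact: IH.
by rewrite mulr_suml big_map; apply: eq_bigr => p _; rewrite mulrA.
Qed.

Definition aug_prod u : AG := \prod_(g <- u) (gel g - 1).

Lemma aug_prod_cons g u : aug_prod (g :: u) = (gel g - 1) * aug_prod u.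
Proof. exact: big_cons. Qed.

Lemma aug_prod_nil : aug_prod [::] = 1. Proof. exact: big_nil. Qed.

Lemma aug_prod1 g : aug_prod [:: g] = gel g - 1.
Proof. by rewrite aug_prod_cons aug_prod_nil mulr1. Qed.

Lemma aug_ideal_gel g : aug_ideal (gel g - 1).
Proof.
rewrite /aug_ideal (linformB augmentation_linear) augmentation_gel.
by rewrite -gel1 augmentation_gel subrr.
Qed.

Lemma aug_prod_pow u : aug_pow (size u) (aug_prod u).
Proof.
elim: u => [//|g u IH]; rewrite aug_prod_cons.
by apply: aug_powMI => //; exact: aug_ideal_gel.
Qed.

(** Subtracting [augmentation x *: f 1] from [f x] gives a linear map that kills every group
    element, hence the whole group ring; on the augmentation ideal it agrees with [f]. *)
Lemma aug_ideal_ind (M : lmodType A) (f : AG -> M) : linear f ->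
  (forall g, f (gel g - 1) = 0) -> forall x, aug_ideal x -> f x = 0.
Proof.
move=> fL f0 x xI.
pose h x := f x - augmentation x *: f 1.
have hL : linear h.
  move=> a y z; rewrite /h fL augmentation_linear scalerDl -scalerA scalerBr opprD.
  by rewrite addrACA.
have : h =1 (fun=> 0).
  apply: gr_linear_ext => // [a y z|g]; first by rewrite scaler0 addr0.
  rewrite /h augmentation_gel scale1r -[RHS](f0 g).
  by have := fL (-1) 1 (gel g); rewrite !scaleN1r ![- _ + _]addrC.
by move=> /(_ x); rewrite /h xI scale0r subr0.
Qed.

(** The power [I^m] is spanned by the products of at least [m] factors [g - 1]. Longer products
    enter because the last cofactor is an arbitrary ring element, expanded by [g = (g - 1) + 1]. *)
Lemma aug_pow_ind (M : lmodType A) (f : AG -> M) m : linear f ->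
  (forall u, (m <= size u)%N -> f (aug_prod u) = 0) ->
  forall x, aug_pow m x -> f x = 0.
Proof.
elim: m f => [|m IH] f fL f0 x.
  move=> _; move: x; apply: gr_linear_ext => // [a y z|g].
    by rewrite scaler0 addr0.
  rewrite -[gel g](subrK 1) -aug_prod1 -aug_prod_nil -[aug_prod [:: g]]scale1r.
  by rewrite fL !f0 // scaler0 addr0.
case=> s [sI ->].
pose h : {linear AG -> M} := HB.pack f (GRing.isLinear.Build _ _ _ _ f fL).
rewrite -[f]/(h : _ -> _) linear_sum big_seq big1 // => p /sI[p1 p2].
apply: (IH (fun y => f (p.1 * y))) p2 => [a y z|u mu].
  by rewrite gr_mull_linear fL.
apply: (@aug_ideal_ind M (fun y => f (y * aug_prod u))) p1 => [a y z|g].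
  by rewrite gr_mulr_linear fL.
by rewrite -aug_prod_cons f0.
Qed.

Lemma group_ring_map_gel (f : group_aut G) g : group_ring_map f (gel g) = gel (f g).
Proof. exact: group_ring_mapU. Qed.

Lemma group_ring_map_prod (f : group_aut G) u :
  group_ring_map f (aug_prod u) = aug_prod (map f u).
Proof.
have f1 : group_ring_map f (1 : AG) = 1 :> AG.
  by have := group_ring_map_gel f 1%g; rewrite aut1.
elim: u => [|g u IH] /=; first by rewrite aug_prod_nil.
by rewrite !aug_prod_cons group_ring_mapM IH linearB /= group_ring_map_gel f1.
Qed.

(* [f a f b - a b = f a (f b - b) + (f a - a) b] for [a], [b] in the augmentation ideal. *)
Lemma johnson_aug_prod (f : group_aut G) k u : f \in johnson A k -> (1 < size u)%N ->
  aug_pow k.+2 (group_ring_map f (aug_prod u) - aug_prod u).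
Proof.
move=> /asboolP fJ; case: u => [|g [|h u]] // _.
rewrite group_ring_map_prod map_cons !(aug_prod_cons _ (_ :: _)).
rewrite -!map_cons -group_ring_map_prod.
set b := aug_prod (h :: u); set fb := group_ring_map f b.
have -> : (gel (f g) - 1) * fb - (gel g - 1) * b =
    (gel (f g) - 1) * (fb - b) + (gel (f g) - gel g) * b.
  have -> : gel (f g) - gel g = (gel (f g) - 1) - (gel g - 1).
    by rewrite opprB addrA subrK.
  by rewrite mulrBr [_ * b in RHS]mulrBl addrA subrK.
apply: aug_powD; first by apply: aug_powMI; [exact: aug_ideal_gel | exact: fJ].
apply: aug_powIM.
  by rewrite -[gel (f g)]group_ring_map_gel; exact: fJ.
rewrite /b aug_prod_cons /aug_ideal augmentationM.
by rewrite (aug_ideal_gel h : augmentation _ = 0) mul0r.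
Qed.

End GroupRingPowers.

(** * Cocycles as linear forms on the group ring *)

Section BarForms.
Variables (A : idomainType) (G : groupType).
Local Notation C := (cochain A G).
Local Notation Bar := (Bar A G).
Local Notation bword := (word C).
Local Notation AG := (group_ring A G).
Local Notation aug_pow := (ideal_pow (@aug_ideal A G)).
Local Notation ones := (map (fun g : G => [:: g])).
Implicit Types (x y : Bar) (z : AG) (u v : seq G) (f : group_aut G).

(** The linear form on [A[G]] attached to a [0]-cocycle [x]: by the cocycle condition,
    it takes the value [x(g_1 | .. | g_p)] at [(g_1 - 1) .. (g_p - 1)]. *)
Definition bar_form x : AG -> A :=
  mlin (fun g => (bev0 [:: g] x + bev0 [::] x : A^o)).

Lemma bar_form_linear x : linear (bar_form x : AG -> A^o).
Proof. exact: mlin_is_linear. Qed.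

Lemma bar_form_gel x g : bar_form x (gel A g) = bev0 [:: g] x + bev0 [::] x.
Proof. exact: (@mlinU A G A^o). Qed.

Lemma bev0_unit x : bev0 [:: 1%g] x = 0.
Proof.
move: x; apply: (tensor_ext (M := A^o) (g := fun=> 0)); first exact: bev0_linear.
  by move=> a x y; rewrite scaler0 addr0.
move=> [|l w]; rewrite -/(bar_word _) /bev0 bev_word //= /ev_simplex.
case: l => n c /=; case: eqP => [n1|_]; last by rewrite mul0r.
subst n; have /asboolP[c0 _] := cval_reduced c.
by rewrite c0 ?mul0r //; exists ord0.
Qed.

Lemma H0_cocycle x : x \in @H0_Bar A G -> cocycle_fun (fun u => bev0 u x).
Proof.
move=> /andP[x0 /eqP dx] u g h v.
have := bev_bar_d (ones u ++ [:: g; h] :: ones v) x0.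
rewrite dx (linform0 (bev_linear _)) bdry_ones => /eqP.
by rewrite eq_sym !subr_eq add0r => /eqP ->; rewrite addrC [X in _ + X]addrC addrA.
Qed.

(** Induction on the length of [u]: the identity [(g - 1)(h - 1) = (gh - 1) - (g - 1) - (h - 1)]
    shortens the product, and the cocycle condition shortens [bev0] in the same way. *)
Lemma H0_form x u : x \in @H0_Bar A G -> bev0 u x = bar_form x (aug_prod A u).
Proof.
move=> /H0_cocycle Fx; have [n] := ubnP (size u).
elim: n u => // n IH [|g [|h u]] /= un.
- by rewrite aug_prod_nil -gel1 bar_form_gel bev0_unit add0r.
- rewrite aug_prod1 (linformB (bar_form_linear x)) bar_form_gel -gel1 bar_form_gel.
  by rewrite bev0_unit add0r addrK.
have -> : aug_prod A [:: g, h & u]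
    = aug_prod A ((g * h)%g :: u) - aug_prod A (g :: u) - aug_prod A (h :: u).
  rewrite !aug_prod_cons mulrA -!mulrBl; congr (_ * _).
  rewrite mulrBl mul1r mulrBr mulr1 -gelM !opprB !addrA subrK.
  by rewrite addrAC.
rewrite !(linformB (bar_form_linear x)) -!IH //=.
have /= -> := Fx [::] g h u.
by rewrite -addrA -opprD addrC addKr.
Qed.

Lemma bar_wt_bev0 (n : nat) x u : x \in @bar_wt A G n -> (n < size u)%N ->
  bev0 u x = 0.
Proof.
move=> xn nu; apply: (tev_size_span (@ev_simplex_linear A G) xn) => w.
by rewrite lez_nat size_map => wn; rewrite neq_ltn (leq_ltn_trans wn nu).
Qed.

Lemma form_pow (n : nat) x z : x \in @H0_Bar_le A G n -> aug_pow n.+1 z ->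
  bar_form x z = 0.
Proof.
move=> /andP[x0 xn]; apply: (aug_pow_ind (M := A^o) (bar_form_linear x)) => u nu.
by rewrite -(H0_form _ x0) (bar_wt_bev0 xn).
Qed.

Lemma bev0_pull f u x : bev0 u (pull_bar f x) = bev0 (map f u) x.
Proof.
move: x; apply: (tensor_ext (M := A^o)).
- by move=> a x y; rewrite pull_bar_linear bev0_linear.
- by move=> a x y; rewrite bev0_linear.
move=> w; rewrite -/(bar_word w) pull_barE /bev0 !bev_word.
elim: u w => [|g u IH] [|l w] //=; rewrite IH; congr (_ * _).
case: l => n c; rewrite /ev_simplex /=; case: eqP => // n1; subst n.
by congr (cval c _); apply: funext => i; rewrite (ord1 i).
Qed.

Lemma bar_form_pull f x z : bar_form (pull_bar f x) z = bar_form x (group_ring_map f z).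
Proof.
move: z; apply: (gr_linear_ext (M := A^o)); first exact: bar_form_linear.
  by move=> a y z; rewrite linearP bar_form_linear.
by move=> g; rewrite group_ring_map_gel !bar_form_gel !bev0_pull.
Qed.

Lemma H0_pull f x : x \in @H0_Bar A G -> pull_bar f x \in @H0_Bar A G.
Proof.
move=> /andP[x0 /eqP dx]; apply/andP; split; first exact: pull_bar_deg.
by rewrite -pull_bar_d dx linear0.
Qed.

Lemma H0_le_pull f n x : x \in @H0_Bar_le A G n -> pull_bar f x \in @H0_Bar_le A G n.
Proof. by case/andP=> /(H0_pull f) x0 xn; rewrite inE x0; exact: pull_bar_wt. Qed.

Lemma H0_sub x y : x \in @H0_Bar A G -> y \in @H0_Bar A G -> x - y \in @H0_Bar A G.
Proof.
move=> /andP[x0 /eqP dx] /andP[y0 /eqP dy].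
by apply/andP; rewrite linearB /= dx dy subrr rpredB.
Qed.

Lemma H0_linear a x y : x \in @H0_Bar A G -> y \in @H0_Bar A G ->
  a *: x + y \in @H0_Bar A G.
Proof.
move=> /andP[x0 /eqP dx] /andP[y0 /eqP dy].
apply/andP; split; first by apply: rpredD => //; exact: rpredZ.
by rewrite bar_d_linear dx dy addr0 scaler0.
Qed.

Lemma H0_le_linear n a x y : x \in @H0_Bar_le A G n -> y \in @H0_Bar_le A G n ->
  a *: x + y \in @H0_Bar_le A G n.
Proof.
move=> /andP[x0 xn] /andP[y0 yn]; apply/andP; split; first exact: (H0_linear a x0 y0).
by apply: rpredD => //; exact: rpredZ.
Qed.

Lemma bev0_H1 u (h : H1 A G) :
  bev0 u (bar_H1 h) = if u is [:: g] then hval h g else 0.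
Proof.
rewrite /bev0 bev_word; case: u => [|g [|g' u]] //=; last by rewrite mulr0.
by rewrite ev_simplex1 mulr1.
Qed.

Lemma bar_H1_inj : injective (@bar_H1 A G).
Proof.
move=> h h' hh'; apply: H1_ext => g.
by have := congr1 (bev0 [:: g]) hh'; rewrite !bev0_H1.
Qed.

Lemma bar_H1_deg (h : H1 A G) : bar_H1 h \in @bar_deg A G 0.
Proof. by apply: tpure_span; rewrite /word_deg big_seq1. Qed.

Hypothesis A_PID : is_PID A.

Lemma H0_inj x y : x \in @H0_Bar A G -> y \in @H0_Bar A G ->
  (forall z, bar_form x z = bar_form y z) -> x = y.
Proof.
move=> x0 y0 xy; apply: (bev0_inj A_PID) => [||u].
- by case/andP: x0.
- by case/andP: y0.
by rewrite (H0_form _ x0) (H0_form _ y0).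
Qed.

(** When the values at pairs vanish, the cocycle identity for single elements is additivity, so
    these values form a homomorphism, which then accounts for all of [x]. *)
Lemma H0_weight1 x : x \in @H0_Bar A G ->
  (forall u, size u != 1%N -> bev0 u x = 0) -> exists h, bar_H1 h = x.
Proof.
move=> xH u1; have Fx := H0_cocycle xH.
have hom : (fun g => bev0 [:: g] x : A^o) \in @is_hom A G.
  by apply/asboolP => g g'; have /= -> := Fx [::] g g' [::]; rewrite (u1 [:: g; g']) // addr0.
exists (MkH1 hom); apply: (bev0_inj A_PID); first exact: bar_H1_deg.
  by case/andP: xH.
by move=> u; rewrite bev0_H1; case: u => [|g [|g' u]] //; rewrite u1.
Qed.

(** On a product of two or more factors [g - 1], [f] moves the argument of [bar_form x] by an
    element of [I^(k+2)], where that form vanishes; the empty product is not moved. Only the values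
    at single elements remain. *)
Lemma johnson_displacement k f x : (0 < k)%N -> f \in johnson A k ->
  x \in @H0_Bar_le A G k.+1 -> exists h, bar_H1 h = x - pull_bar f x.
Proof.
move=> k0 fJ xk; have /andP[x0 xwt] := xk.
have yH : x - pull_bar f x \in @H0_Bar A G by exact: (H0_sub x0 (H0_pull f x0)).
apply: (H0_weight1 yH) => u u1.
rewrite (linformB (bev0_linear u)) bev0_pull !(H0_form _ x0); apply/eqP.
rewrite subr_eq0 eq_sym -subr_eq0 -group_ring_map_prod -(linformB (bar_form_linear x)).
apply/eqP; case: u u1 => [|g [|h u]] // _; last first.
  by apply: (form_pow xk); exact: johnson_aug_prod.
by rewrite group_ring_map_prod subrr (linform0 (bar_form_linear x)).
Qed.

(** [f] moves every element of [A[G]] by an element of [I^(k+1)], and the form of a cocycle of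
    weight at most [k] kills that ideal. *)
Lemma johnson_fixes k f x : f \in johnson A k -> x \in @H0_Bar_le A G k ->
  pull_bar f x = x.
Proof.
move=> /asboolP fJ xk; have /andP[x0 _] := xk.
apply: (H0_inj (H0_pull f x0) x0) => z; rewrite bar_form_pull; apply/eqP.
by rewrite -subr_eq0 -(linformB (bar_form_linear x)) (form_pow xk).
Qed.

End BarForms.

(** * Leading terms *)

Section WeightComponents.
Variables (A : comNzRingType) (I : choiceType) (V : I -> lmodType A).

Lemma multilinear_size (M : lmodType A) (P : pred nat) (F : word V -> M) :
  multilinear F -> multilinear (fun w => if P (size w) then F w else 0).
Proof.
move=> Fml u w i a v v'; rewrite !size_cat /=; case: ifP => _; first exact: Fml.
by rewrite scaler0 addr0.
Qed.

Definition twt (P : pred nat) : tensor V -> tensor V :=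
  tlift (fun w => if P (size w) then tpure w else 0).

Lemma twt_multilinear P :
  multilinear (fun w : word V => if P (size w) then tpure w else 0).
Proof. exact/multilinear_size/tpure_multilinear. Qed.

Lemma twt_linear P : linear (twt P).
Proof. exact/tlift_linear/twt_multilinear. Qed.

Lemma twt_pure P w : twt P (tpure w) = if P (size w) then tpure w else 0.
Proof. exact: (tlift_pure (twt_multilinear P)). Qed.

Lemma twtC P t : t = twt P t + twt (predC P) t.
Proof.
move: t; apply: (tensor_ext (f := id)) => // [a t s|w].
  by rewrite !twt_linear scalerDr addrACA.
by rewrite !twt_pure /=; case: (P _); rewrite ?addr0 ?add0r.
Qed.

Lemma twt_span (P : pred nat) (Q R : pred (word V)) t : t \in tspan Q ->
  (forall w, Q w -> P (size w) -> R w) -> twt P t \in tspan R.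
Proof.
move=> tQ PQR; apply: (tspan_lift (twt_multilinear P)) tQ => w Qw.
case: ifP => [Pw|_]; last exact: rpred0.
by apply: tpure_span; exact: PQR.
Qed.

End WeightComponents.

Section LeadingTerms.
Variables (A : idomainType) (G : groupType).
Local Notation C := (cochain A G).
Local Notation H := (fun _ : unit => H1 A G).
Local Notation Bar := (Bar A G).
Local Notation bword := (word C).
Local Notation T := (talg Bar).
Implicit Types (x y : Bar) (t : talg (H1 A G)) (u v : seq G) (s : seq Bar).

Definition bar_letter (l : letter C) : Bar := bar_word [:: l].

Lemma redcoprod_head_tensor x s :
  redcoprod_head (bar_tensor (x :: s)) = tcat (bar_redcoprod x) (map (@tvec A Bar) s).
Proof. exact: (tlift_pure (@redcoprod_head_multilinear A G)). Qed.

Lemma tcat_tensor x y s :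
  tcat (bar_tensor [:: x; y]) (map (@tvec A Bar) s) = bar_tensor [:: x, y & s].
Proof. exact: (tlift_pure (@tcat_multilinear A G _)). Qed.

Lemma bar_red_cons l (w : bword) : bar_red (bar_word (l :: w)) = bar_word (l :: w).
Proof. by rewrite /bar_red bar_counitE scale0r subr0. Qed.

Lemma bar_red_nil : bar_red (bar_word ([::] : bword)) = 0.
Proof. by rewrite /bar_red bar_counitE scale1r subrr. Qed.

Lemma bar_redcoprod_cons l (w : bword) : bar_redcoprod (bar_word (l :: w)) =
  \sum_(i < size w) bar_tensor [:: bar_word (l :: take i w); bar_word (drop i w)].
Proof.
rewrite /bar_redcoprod bar_red_cons bar_coprodE /bar_coprod_word /=.
rewrite big_ord_recl big_ord_recr /= take_size drop_size -!/(bar_one A G).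
by rewrite addrAC [X in X - _ - _]addrC !addrK.
Qed.

Lemma iter_linear (M : lmodType A) (f : M -> M) n : linear f -> linear (iter n f).
Proof. by move=> fL a x y; elim: n => //= n ->; rewrite fL. Qed.

Lemma linear_sumE (M M' : lmodType A) (f : M -> M') (fL : linear f) (K : Type)
    (r : seq K) (F : K -> M) : f (\sum_(i <- r) F i) = \sum_(i <- r) f (F i).
Proof.
pose f' : {linear M -> M'} := HB.pack f (GRing.isLinear.Build _ _ _ _ f fL).
exact: (linear_sum f').
Qed.

Lemma linear_0E (M M' : lmodType A) (f : M -> M') (fL : linear f) : f 0 = 0.
Proof. by have := linear_sumE fL [::] (fun i : unit => 0); rewrite !big_nil. Qed.

Lemma redcoprod_head_cons l (w : bword) s :
  redcoprod_head (bar_tensor (bar_word (l :: w) :: s)) =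
  \sum_(i < size w) bar_tensor [:: bar_word (l :: take i w), bar_word (drop i w) & s].
Proof.
rewrite redcoprod_head_tensor bar_redcoprod_cons (linear_sumE (@tcat_linear A G _)).
by apply: eq_bigr => i _; rewrite tcat_tensor.
Qed.

(* Cutting a word of length [m.+1] into [m.+1] nonempty pieces cuts it into its letters. *)
Lemma redcoprod_iter_word m l (w : bword) s : (size w <= m)%N ->
  iter m (@redcoprod_head A G) (bar_tensor (bar_word (l :: w) :: s)) =
  if size w == m then bar_tensor (map bar_letter (l :: w) ++ s) else 0.
Proof.
elim: m l w s => [|m IH] l w s; first by case: w.
move=> wm; rewrite iterSr redcoprod_head_cons.
rewrite (linear_sumE (iter_linear m (@redcoprod_head_linear A G))).
have szi (i : 'I_(size w)) : size (take i w) = i by rewrite size_takel // ltnW.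
(* Only the cut [i = m] survives the [m] remaining cuts; there the second piece is the last letter
   of [w]. *)
rewrite (eq_bigr (fun i : 'I_(size w) => if (i : nat) == m then
    bar_tensor (bar_letter l :: map bar_letter w ++ s) else 0)); last first.
  move=> i _; rewrite IH szi; last by rewrite -ltnS (leq_trans _ wm).
  case: eqP => // im; congr (bar_tensor (_ :: _)).
  have wE : size (drop i w) = 1%N.
    rewrite size_drop; apply/eqP; rewrite eqn_leq subn_gt0 ltn_ord andbT.
    by rewrite leq_subLR im addn1.
  rewrite -[in RHS](cat_take_drop i w) map_cat -catA; congr (_ ++ _).
  by case: (drop i w) wE => [|a [|b d]].
have [wE|wn] := eqVneq (size w) m.+1.
  by rewrite wE big_ord_recr /= eqxx big1 ?add0r // => i _; rewrite ltn_eqF.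
rewrite big1 // => i _; rewrite ltn_eqF // (leq_trans (ltn_ord i)) //.
by rewrite -ltnS ltn_neqAle wn.
Qed.

(** The component of weight [n], with each letter regarded as an element of [Bar] of weight one. *)
Definition top_word n (w : bword) : T :=
  if size w == n then bar_tensor (map bar_letter w) else 0.

Lemma top_word_multilinear n : multilinear (top_word n).
Proof.
apply: (@multilinear_size _ _ _ _ (fun k => k == n)) => u w i a v v'.
rewrite /bar_tensor !map_cat /= -tpure_multilinear; congr (tpure (_ ++ mkletter _ :: _)).
exact: (tpure_multilinear [::] [::]).
Qed.

Definition top n : Bar -> T := tlift (top_word n).

Lemma top_linear n : linear (top n).
Proof. exact/tlift_linear/top_word_multilinear. Qed.

Lemma topE n w : top n (bar_word w) = top_word n w.
Proof. exact/tlift_pure/top_word_multilinear. Qed.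

Lemma bar_tensor1_linear : linear (fun x => bar_tensor [:: x]).
Proof. by move=> a x y; exact: (tpure_multilinear [::] [::]). Qed.

Lemma redcoprod_iter_linear m : linear (@redcoprod_iter A G m).
Proof.
move=> a x y; rewrite /redcoprod_iter bar_red_linear bar_tensor1_linear.
exact/iter_linear/redcoprod_head_linear.
Qed.

(** Words with fewer than [n] letters cannot be cut into [n] nonempty pieces, and words with [n]
    letters can be cut in one way only. *)
Lemma redcoprod_iter_top n x : (0 < n)%N -> x \in @bar_wt A G n ->
  redcoprod_iter n.-1 x = top n x.
Proof.
move=> n0; apply: tspan_ind; [exact: redcoprod_iter_linear|exact: top_linear|].
move=> w; rewrite lez_nat -/(bar_word w) topE /redcoprod_iter => wn.
case: w wn => [|l w] wn.
  rewrite bar_red_nil /top_word /= ltn_eqF //.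
  rewrite (linear_0E bar_tensor1_linear).
  exact: (linear_0E (iter_linear _ (@redcoprod_head_linear A G))).
rewrite bar_red_cons redcoprod_iter_word; last by case: n n0 wn.
by rewrite cats0 /top_word; case: n n0 wn.
Qed.

Definition ev_barletter (g : G) (l : letter (fun _ : unit => Bar)) : A :=
  bev0 [:: g] (tagged l).

Lemma ev_barletter_linear g i :
  linear (fun x => ev_barletter g (mkletter (V := fun _ : unit => Bar) (i := i) x) : A^o).
Proof. exact: bev0_linear. Qed.

Lemma tev_top n u x : size u = n -> tev ev_barletter u (top n x) = bev0 u x.
Proof.
move=> un; move: x; apply: (tensor_ext (M := A^o)).
- by move=> a x y; rewrite top_linear (tev_linear ev_barletter_linear).
- exact: bev0_linear.
move=> w; rewrite -/(bar_word w) topE /bev0 bev_word /top_word -un.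
case: eqP => [wu|wu]; last first.
  rewrite (linform0 (tev_linear ev_barletter_linear _)).
  by rewrite ev_word_size // size_map; apply/eqP.
rewrite /bar_tensor (tev_pure ev_barletter_linear) {wu un}.
elim: u w => [|g u IH] [|l w] //=; rewrite IH; congr (_ * _).
by rewrite /ev_barletter /= /bev0 bev_word /= mulr1.
Qed.

Lemma tev_tmap_H1 u t :
  tev ev_barletter u (tmap (r := id) (fun _ : unit => @bar_H1 A G) t) = hev u t.
Proof.
move: t; apply: (tensor_ext (M := A^o)).
- move=> a t s; rewrite tmap_linear; last by move=> _; exact: bar_H1_linear.
  by rewrite (tev_linear ev_barletter_linear).
- exact: hev_linear.
move=> w; rewrite tmap_pure; last by move=> _; exact: bar_H1_linear.
rewrite /hev (tev_pure ev_barletter_linear) (tev_pure (@ev_H1_linear A G)).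
elim: u w => [|g u IH] [|l w] //=; rewrite IH; congr (_ * _).
by rewrite /ev_barletter /= bev0_H1.
Qed.

Lemma hev_tpow n u t : t \in @tpow A (H1 A G) n -> size u != n -> hev u t = 0.
Proof.
move=> tn un; apply: (tev_size_span (@ev_H1_linear A G) tn) => w /eqP ->.
by rewrite eq_sym.
Qed.

Lemma bev0_symbol u t : bev0 u (symbol t) = hev u t.
Proof.
move: t; apply: (tensor_ext (M := A^o)).
- by move=> a t s; rewrite symbol_linear bev0_linear.
- exact: hev_linear.
move=> w; rewrite /symbol tmap_pure; last by move=> _; exact: H1_cochain_linear.
rewrite -/(bar_word _) /bev0 bev_word /hev (tev_pure (@ev_H1_linear A G)).
elim: u w => [|g u IH] [|l w] //=; rewrite IH; congr (_ * _).
Qed.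

Lemma symbol_deg t : symbol t \in @bar_deg A G 0.
Proof.
have [n tn] := tensor_fullspan t; move: tn; apply: tmap_span => [_|w _].
  exact: H1_cochain_linear.
by rewrite /word_deg big_map big1.
Qed.

Lemma bev0_twt P u x : bev0 u (twt P x) = if P (size u) then bev0 u x else 0.
Proof.
move: x; apply: (tensor_ext (M := A^o)).
- by move=> a x y; rewrite twt_linear bev0_linear.
- by move=> a x y; case: ifP => _; [exact: bev0_linear | rewrite scaler0 addr0].
move=> w; rewrite twt_pure -/(bar_word w) (fun_if (bev0 u)).
rewrite (linform0 (bev0_linear u)) /bev0 bev_word.
have [->|wu] := eqVneq (size w) (size u); first by [].
by rewrite ev_word_size ?size_map // !if_same.
Qed.

Lemma is_lead_bev0 n x t u : (0 < n)%N -> x \in @bar_wt A G n -> is_lead n x t ->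
  size u = n -> bev0 u x = hev u t.
Proof.
by move=> n0 xn [_ xt] un; rewrite -tev_tmap_H1 xt redcoprod_iter_top // tev_top.
Qed.

Hypothesis A_PID : is_PID A.

Lemma twt_symbol n x t : x \in @bar_deg A G 0 -> t \in @tpow A (H1 A G) n ->
  (forall u, size u = n -> bev0 u x = hev u t) -> twt (pred1 n) x = symbol t.
Proof.
move=> x0 tn xt; apply: (bev0_inj A_PID); last 1 first.
- move=> u; rewrite bev0_twt bev0_symbol /=; case: eqP => [/xt//|/eqP un].
  by rewrite (hev_tpow tn).
- exact: (twt_span x0).
exact: symbol_deg.
Qed.

Lemma sub_symbol_wt n x t : (0 < n)%N -> x \in @bar_deg A G 0 -> x \in @bar_wt A G n ->
  t \in @tpow A (H1 A G) n -> (forall u, size u = n -> bev0 u x = hev u t) ->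
  x - symbol t \in @bar_wt A G (n%:Z - 1).
Proof.
move=> n0 x0 xn tn xt; rewrite {1}(twtC (pred1 n) x) (twt_symbol x0 tn xt) addrC addKr.
apply: (twt_span xn) => w /= wn wn'.
by rewrite lerBrDr -PoszD addn1 lez_nat ltn_neqAle wn'.
Qed.

(** Converse of [is_lead_bev0]: a leading term can be tested on [n]-tuples, since evaluations
    identify the component of weight [n] of [x] with [symbol t]. *)
Lemma bev0_is_lead n x t : (0 < n)%N -> x \in @bar_deg A G 0 -> x \in @bar_wt A G n ->
  t \in @tpow A (H1 A G) n -> (forall u, size u = n -> bev0 u x = hev u t) ->
  is_lead n x t.
Proof.
move=> n0 x0 xn tn xt; split=> //; rewrite redcoprod_iter_top //.
have -> : top n x = top n (twt (pred1 n) x).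
  move: (x); apply: tensor_ext => [||w]; first exact: top_linear.
    by move=> a y z; rewrite twt_linear top_linear.
  rewrite twt_pure /= -/(bar_word w) (fun_if (top n)) topE (linear_0E (top_linear n)).
  by rewrite /top_word; case: eqP.
rewrite (twt_symbol x0 tn xt); move: tn.
apply: (tspan_ind (f := tmap (r := id) (fun _ : unit => @bar_H1 A G))
                  (g := fun t => top n (symbol t))).
- by apply: tmap_linear => _; exact: bar_H1_linear.
- by move=> a y z; rewrite symbol_linear top_linear.
move=> w wn; rewrite tmap_pure; last by move=> _; exact: bar_H1_linear.
rewrite /symbol tmap_pure; last by move=> _; exact: H1_cochain_linear.
rewrite -/(bar_word _) topE /top_word size_map wn /bar_tensor -!map_comp.
by congr tpure; apply: eq_map => -[[] h].
Qed.

End LeadingTerms.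

(** * The image of the leading-term map *)

Section LeadingTermImage.
Variables (A : idomainType) (G : groupType).
Local Notation C := (cochain A G).
Local Notation H := (fun _ : unit => H1 A G).
Local Notation Bar := (Bar A G).
Local Notation ones := (map (fun g : G => [:: g])).
Implicit Types (x y : Bar) (t : talg (H1 A G)) (u v : seq G).

(** Each word evaluates to a product of a function of the first variable and a function of the
    others, and [y] is a finite sum of words; this finiteness makes [fun_split] applicable. *)
Lemma bev0_finite_rank y : exists s : seq ((G -> A) * (seq G -> A)),
  forall g v, bev0 (g :: v) y = \sum_(p <- s) p.1 g * p.2 v.
Proof.
exists [seq (fun g => if w is l :: _ then (trepr y)@_w * ev_simplex [:: g] l else 0,
             fun v => if w is _ :: w' then ev_word (@ev_simplex A G) (ones v) w' else 0)
        | w : word C <- msupp (trepr y)] => g v.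
rewrite big_map -{1}[y]treprK [LHS](tlift_pi (ev_word_multilinear (@ev_simplex_linear A G) _)).
apply: eq_bigr => -[|l w] _ /=; first by rewrite scaler0 mul0r.
by rewrite -mulrA.
Qed.

Hypothesis A_PID : is_PID A.

Lemma fun_split (X : Type) (s : seq (X -> A^o)) :
  exists D : seq ((X -> A) * seq (A * X)), forall f, f \in s -> forall z,
    f z = \sum_(p <- D) (\sum_(b <- p.2) b.1 * f b.2) * p.1 z :> A.
Proof.
have [] := @pid_split A (X -> A^o) X (fun z f => f z) _ A_PID _ s.
- by [].
- move=> f d /choose_quotient[q qE]; exists q.
  by apply: funext => z; exact: (qE z).1.
move=> D DP; exists D => f /DP {1}-> z; rewrite fct_sumE.
by apply: eq_bigr.
Qed.

Definition multiadditive n (F : seq G -> A) := forall u v g h,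
  (size u + size v).+1 = n ->
  F (u ++ (g * h)%g :: v) = F (u ++ g :: v) + F (u ++ h :: v).

(* The partial evaluations of [y] have finite rank, so that by [fun_split] they are
   combinations of finitely many functions which are evaluations of [y] in all the
   variables but the first one, and are therefore additive. *)
Lemma bev0_cons_H1 n y : multiadditive n.+1 (fun u => bev0 u y) ->
  exists E : seq (H1 A G * seq (A * G)), forall g v, size v = n ->
    bev0 (g :: v) y
    = \sum_(p <- E) (p.1 g : A) * \sum_(b <- p.2) b.1 * bev0 (b.2 :: v) y.
Proof.
move=> yM; have [s sE] := bev0_finite_rank y.
(* Cutting off at length [n] confines everything to tuples of length [n.+1], the ones where [y] is
   known to be additive. *)
pose tau (p : (G -> A) * (seq G -> A)) : seq G -> A^o :=
  fun v => if size v == n then p.2 v else 0.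
have [D DE] := fun_split (map tau s).
(* The coefficient of the function [b.1] in [y(g, -)]: a combination of values of [y] at tuples
   starting with [g], hence additive in [g]. *)
pose hfun (b : (seq G -> A) * seq (A * seq G)) (g : G) : A :=
  \sum_(c <- b.2) c.1 * (if size c.2 == n then bev0 (g :: c.2) y else 0).
have hfun_hom b : (hfun b : G -> A^o) \in @is_hom A G.
  apply/asboolP => g g'; rewrite -big_split; apply: eq_bigr => c _ /=.
  case: eqP => [cn|_]; last by rewrite mulr0 addr0.
  by rewrite -mulrDr (yM [::] c.2 g g') //= cn.
pose h b := MkH1 (hfun_hom b).
have yE g v : size v = n -> bev0 (g :: v) y = \sum_(b <- D) hfun b g * b.1 v.
  move=> vn; transitivity (\sum_(p <- s) p.1 g * tau p v).
    by rewrite sE; apply: eq_bigr => p _; rewrite /tau vn eqxx.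
  rewrite big_seq; under eq_bigr => p ps.
    rewrite (DE _ (map_f tau ps)) mulr_sumr; over.
  rewrite -big_seq exchange_big; apply: eq_bigr => b _ /=.
  rewrite /hfun; under eq_bigr do rewrite mulrA.
  rewrite -mulr_suml; congr (_ * _).
  under eq_bigr do rewrite mulr_sumr.
  rewrite exchange_big; apply: eq_bigr => c _ /=.
  rewrite /tau; case: eqP => _; last first.
    by rewrite mulr0 big1 // => p _; rewrite !mulr0.
  by rewrite sE mulr_sumr; apply: eq_bigr => p _; rewrite mulrCA.
(* A second splitting, now of the homomorphisms [h b], has evaluations of [hfun b] as coordinates;
   summing over [D] turns them back into values of [y]. *)
have [E EE] := H1_split A_PID (map h D).
exists E => g v vn; rewrite yE // big_seq; under eq_bigr => b bD.
  have -> : hfun b g = \sum_(p <- E) (\sum_(d <- p.2) d.1 * hfun b d.2) * (p.1 g : A).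
    have hE : linear (fun h' : H1 A G => hval h' g : A^o) by [].
    rewrite -[LHS]/(hval (h b) g) (EE _ (map_f h bD)) (linform_sum hE).
    by apply: eq_bigr => p _; exact: (linformZ hE).
  rewrite mulr_suml; over.
rewrite -big_seq exchange_big; apply: eq_bigr => p _ /=.
transitivity (\sum_(b <- D) \sum_(d <- p.2)
    (p.1 g : A) * (d.1 * (hfun b d.2 * b.1 v))).
  apply: eq_bigr => b _; rewrite !mulr_suml; apply: eq_bigr => d _.
  by ring.
rewrite exchange_big mulr_sumr; apply: eq_bigr => d _ /=.
by rewrite yE // !mulr_sumr.
Qed.

Lemma hev_cons g v (l : letter H) t : hev (g :: v) (tcons l t) = ev_H1 g l * hev v t.
Proof. exact/tev_tcons/ev_H1_linear. Qed.

Lemma tcons_tpow n (l : letter H) t :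
  t \in @tpow A (H1 A G) n -> tcons l t \in @tpow A (H1 A G) n.+1.
Proof.
apply: (tspan_lift (tcons_multilinear l)) => w wn; apply: tpure_span.
by rewrite /= eqSS.
Qed.

(** Induction on [n]: [bev0_cons_H1] splits off the first variable, and the remaining factors are
    values of combinations of slices of [y], which are again elements of [Bar] and additive in each
    remaining variable. *)
Lemma multiadditive_tensor n y : multiadditive n (fun u => bev0 u y) ->
  exists2 t, t \in @tpow A (H1 A G) n & forall u, size u = n -> bev0 u y = hev u t.
Proof.
elim: n y => [|n IH] y yM.
  exists (bev0 [::] y *: tpure ([::] : word H)).
    by apply: rpredZ; exact: tpure_span.
  move=> [|//] _; rewrite (linformZ (hev_linear _)) /hev (tev_pure (@ev_H1_linear A G)).
  by rewrite mulr1.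
have [E yE] := bev0_cons_H1 yM.
pose z (b : seq (A * G)) : Bar := \sum_(d <- b) d.1 *: tslice (@ev_simplex A G) [:: d.2] y.
have zE b v : bev0 v (z b) = \sum_(d <- b) d.1 * bev0 (d.2 :: v) y.
  rewrite (linform_sum (bev0_linear v)); apply: eq_bigr => d _.
  by rewrite (linformZ (bev0_linear v)) /bev0 /= bev_cons.
have /choice[tt ttP] b : exists t, t \in @tpow A (H1 A G) n /\
    forall u, size u = n -> bev0 u (z b) = hev u t.
  have [|t tn tE] := IH (z b); last by exists t.
  move=> u v g h un; rewrite !zE -big_split; apply: eq_bigr => d _ /=.
  by rewrite -mulrDr; congr (_ * _); apply: (yM (d.2 :: u)); rewrite /= -un.
exists (\sum_(p <- E) tcons (tvec p.1) (tt p.2)).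
  by apply: rpred_sum => p _; apply: tcons_tpow; exact: (ttP _).1.
case=> [//|g v] [vn]; rewrite (linform_sum (hev_linear _)) yE //.
apply: eq_bigr => p _; rewrite hev_cons -(ttP _).2 // zE.
by [].
Qed.

(** In top weight the term [F(.., g, h, ..)] of the cocycle identity has [n + 1] entries and
    vanishes, so [F] is additive in each of [n] variables. As [bar_d x = 0], the pair of [x] and [0]
    witnesses the vanishing of every differential. *)
Lemma H0_lead n x : (0 < n)%N -> x \in @H0_Bar_le A G n ->
  exists2 t, t \in @massey_vanish A G n & is_lead n x t.
Proof.
move=> n0 xn; have /andP[xH xwt] := xn; have /andP[x0 /eqP dx] := xH.
have [|t tn tE] := @multiadditive_tensor n x.
  move=> u v g h un; rewrite (H0_cocycle xH).
  rewrite (@bar_wt_bev0 _ _ _ _ (u ++ [:: g, h & v]) xwt) ?addr0 //.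
  by rewrite size_cat /= !addnS un.
exists t; last exact: bev0_is_lead.
apply/andP; split=> //; apply/asboolP => r r0; exists x, 0; split.
- by apply/and3P; split=> //; rewrite dx rpred0.
- exact: sub_symbol_wt.
- exact: wss_cycle0.
- by rewrite dx linear0 subrr rpred0.
Qed.

Lemma massey_lift n t : (0 < n)%N -> t \in @massey_vanish A G n ->
  exists2 x, x \in @H0_Bar_le A G n & is_lead n x t.
Proof.
(* The case [r = n + 1] gives a representative whose differential has weight at most [-1], hence is
   zero. *)
move=> n0 /andP[tn /asboolP/(_ n.+1 isT)[x [_ [/and3P[x0 xn dx] xt _ _]]]].
have dx0 : bar_d x = 0.
  apply: (tspan_ind (f := id) (g := fun=> 0)) dx => // [a y z|w].
    by rewrite scaler0 addr0.
  by rewrite -addn1 PoszD opprD addrA subrr add0r.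
exists x; first by apply/andP; split=> //; apply/andP; rewrite dx0.
apply: bev0_is_lead => // u un.
apply/eqP; rewrite -bev0_symbol -subr_eq0 -(linformB (bev0_linear u)).
by rewrite (@bar_wt_bev0 A G n.-1) ?un ?prednK // predn_int.
Qed.

Lemma lead_unique n x t s : (0 < n)%N -> x \in @bar_wt A G n ->
  is_lead n x t -> is_lead n x s -> t = s.
Proof.
move=> n0 xn xt xs; apply: (hev_inj A_PID) => u.
have [un|un] := eqVneq (size u) n.
  by rewrite -(is_lead_bev0 n0 xn xt) // -(is_lead_bev0 n0 xn xs).
by rewrite (hev_tpow xt.1) // (hev_tpow xs.1).
Qed.

End LeadingTermImage.

(** * Separating forms on torsion-free quotients *)

Section TorsionFreeSeparation.
Variables (A : idomainType) (M : lmodType A) (N : M -> Prop).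
Hypothesis N0 : N 0.
Hypothesis N_linear : forall a x y, N x -> N y -> N (a *: x + y).

Lemma subN x y : N x -> N y -> N (x - y).
Proof. by move=> xN yN; rewrite addrC -scaleN1r; exact: N_linear. Qed.

Lemma scaleNP a x : N x -> N (a *: x).
Proof. by move=> xN; rewrite -[a *: x]addr0; exact: N_linear. Qed.

Lemma addN x y : N x -> N y -> N (x + y).
Proof. by move=> xN yN; rewrite -[x]scale1r; exact: N_linear. Qed.

Definition comb_of (e : seq M) (c : M -> A) : M := \sum_(m <- e) c m *: m.

Lemma comb_ofP e a c c' :
  comb_of e (fun m => a * c m + c' m) = a *: comb_of e c + comb_of e c'.
Proof.
rewrite /comb_of scaler_sumr -big_split; apply: eq_bigr => m _ /=.
by rewrite scalerDl scalerA.
Qed.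

Lemma comb_of0 e : comb_of e (fun=> 0) = 0.
Proof. by rewrite /comb_of big1 // => m _; rewrite scale0r. Qed.

Lemma comb_ofZ e a c : comb_of e (fun m => a * c m) = a *: comb_of e c.
Proof.
rewrite -[RHS]addr0 -(comb_of0 e) -comb_ofP.
by congr comb_of; apply: funext => m; rewrite addr0.
Qed.

Lemma eq_comb_of e c c' : {in e, c =1 c'} -> comb_of e c = comb_of e c'.
Proof.
by move=> cc'; rewrite /comb_of !big_seq; apply: eq_bigr => m /cc' ->.
Qed.

Lemma comb_of_delta e m : uniq e -> m \in e ->
  comb_of e (fun x => (x == m)%:R) = m.
Proof.
move=> eU me; rewrite /comb_of (bigD1_seq m) //= eqxx scale1r big1 ?addr0 // => x.
by move=> /negPf ->; rewrite scale0r.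
Qed.

Definition independent_mod (e : seq M) := forall c, N (comb_of e c) ->
  forall m, m \in e -> c m = 0.

(** Greedy choice: a vector with a nonzero multiple in the span of [e] modulo [N] only enlarges the
    common denominator [a]; any other vector is added to [e]. *)
Lemma max_independent (b : seq M) : exists e a, [/\ uniq e, independent_mod e, a != 0
  & forall m, m \in b -> exists c, N (a *: m - comb_of e c)].
Proof.
elim: b => [|m b [e [a [eU eI a0 eb]]]].
  by exists [::], 1; split=> //; exact: oner_neq0.
have [[d [c [d0 dm]]]|nodep] :=
    pselect (exists d c, d != 0 /\ N (d *: m - comb_of e c)).
  exists e, (a * d); split=> // [|x]; first by rewrite mulf_neq0.
  rewrite inE => /predU1P[->|/eb[c' c'x]].
    exists (fun y => a * c y); rewrite comb_ofZ.
    by rewrite -scalerA -scalerBr; exact: scaleNP.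
  exists (fun y => d * c' y); rewrite comb_ofZ.
  by rewrite mulrC -scalerA -scalerBr; exact: scaleNP.
have me : m \notin e.
  apply/negP => me; apply: nodep; exists 1, (fun x => (x == m)%:R).
  by rewrite comb_of_delta // scale1r subrr oner_neq0.
have combS c : comb_of (m :: e) c = c m *: m + comb_of e c by exact: big_cons.
exists (m :: e), a; split=> //= [|c|x].
- by rewrite me.
- rewrite combS => cN.
  have cm0 : c m = 0.
    apply/eqP; apply: contraT => cm; case: nodep; exists (c m), (fun y => -1 * c y).
    by rewrite comb_ofZ scaleN1r opprK.
  move: cN; rewrite cm0 scale0r add0r => /eI cE x.
  by rewrite inE => /predU1P[->|/cE].
- rewrite inE => /predU1P[->|/eb[c cx]].
    exists (fun y => a * (y == m)%:R); rewrite combS eqxx mulr1.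
    rewrite (eq_comb_of (c' := fun=> 0)); first by rewrite comb_of0 addr0 subrr.
    move=> y ye; case: eqP => [ym|_]; last exact: mulr0.
    by rewrite -ym ye in me.
  exists (fun y => if y == m then 0 else c y); rewrite combS eqxx scale0r add0r.
  rewrite (eq_comb_of (c' := c)) // => y ye.
  by case: eqP => // ym; rewrite -ym ye in me.
Qed.

Hypothesis N_tf : forall a x, a != 0 -> N (a *: x) -> N x.

(* A maximal independent family modulo [N] has coordinates, after multiplication by a
   common denominator [a]; they are linear forms killing [N] and jointly injective. *)
Lemma separating_forms (b : seq M) :
  (forall z, exists c, N (z - comb_of b c)) ->
  forall z, (forall phi : M -> A, linear (phi : M -> A^o) ->
    (forall y, N y -> phi y = 0) -> phi z = 0) -> N z.
Proof.
move=> bgen z zphi; have [e [a [eU eI a0 eb]]] := max_independent b.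
have /choice[c cP] y : exists c, N (a *: y - comb_of e c).
  have [d dy] := bgen y.
  suff [c cd] : exists c, N (a *: comb_of b d - comb_of e c).
    exists c; rewrite -(subrKA (a *: comb_of b d)) -scalerBr.
    by apply: addN => //; exact: scaleNP.
  rewrite /comb_of; elim: (b) eb => [|m b' IH] eb.
    by exists (fun=> 0); rewrite big_nil scaler0 -/(comb_of _ _) comb_of0 subrr.
  have [|c1 c1P] := IH; first by move=> x xb; apply: eb; rewrite inE xb orbT.
  have [c2 c2P] := eb m (mem_head _ _).
  exists (fun x => d m * c2 x + c1 x); rewrite -/(comb_of e _) comb_ofP big_cons scalerDr.
  rewrite scalerA mulrC -scalerA opprD addrACA -scalerBr; exact: N_linear.
(* Independence makes the coordinates unique, which gives both their linearity and their vanishing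
   on [N]. *)
have c_uniq y c' : N (a *: y - comb_of e c') -> {in e, c y =1 c'}.
  move=> c'P m me; apply/eqP; rewrite -subr_eq0; apply/eqP.
  have := subN c'P (cP y); rewrite opprB addrC addrA subrK => c'N.
  have : N (comb_of e (fun x => -1 * c' x + c y x)).
    by rewrite comb_ofP scaleN1r addrC.
  by move=> /eI/(_ m me); rewrite mulN1r addrC.
(* By torsion-freeness it is enough to treat [a *: z], whose coordinates are values at [z] of forms
   killing [N], hence zero. *)
apply: (N_tf a0); rewrite -[_ *: z]subr0.
have <- : comb_of e (c z) = 0.
  rewrite /comb_of big_seq big1 // => m me; rewrite [c z m](zphi (fun y => c y m)) ?scale0r //.
    move=> k x y; apply: (c_uniq _ (fun m => k * c x m + c y m)) => //.
    rewrite comb_ofP scalerDr scalerA mulrC -scalerA opprD addrACA -scalerBr.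
    exact: N_linear.
  move=> y yN; apply: (c_uniq y (fun=> 0)) => //.
  by rewrite comb_of0 subr0; exact: scaleNP.
exact: cP.
Qed.

End TorsionFreeSeparation.

(** * Cocycles from linear forms, for finitely generated groups *)

Section FinitelyGenerated.
Variables (A : comNzRingType) (G : groupType).
Local Notation AG := (group_ring A G).
Local Notation aug_pow := (ideal_pow (@aug_ideal A G)).
Implicit Types (x y z : AG).

Lemma aug_decomposition z :
  z = augmentation z *: (1 : AG) + \sum_(g <- msupp z) (z@_g *: (gel A g - 1) : AG).
Proof.
pose f z : AG := augmentation z *: (1 : AG) + (mlin (fun g => gel A g - 1) z : AG).
rewrite -[RHS]/(f z); move: z; apply: (gr_linear_ext (f := id)) => //.
  move=> a y z; rewrite /f augmentation_linear (linearP (mlin _)) scalerDl -scalerA.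
  by rewrite addrACA -scalerDr.
by move=> g; rewrite /f augmentation_gel scale1r mlinU subrKC.
Qed.

Section RightIdeal.
Variable s : seq G.

Definition gen_right_ideal z := exists2 e : seq (G * AG),
  (forall p, p \in e -> p.1 \in s) & z = \sum_(p <- e) (gel A p.1 - 1) * p.2.

Lemma gen_right_ideal0 : gen_right_ideal 0.
Proof. by exists [::]; rewrite ?big_nil. Qed.

Lemma gen_right_idealD x y :
  gen_right_ideal x -> gen_right_ideal y -> gen_right_ideal (x + y).
Proof.
move=> [e es ->] [e' es' ->]; exists (e ++ e'); last by rewrite big_cat.
by move=> p; rewrite mem_cat => /orP[/es|/es'].
Qed.

Lemma gen_right_idealM x y : gen_right_ideal x -> gen_right_ideal (x * y).
Proof.
move=> [e es ->]; exists [seq (p.1, p.2 * y) | p <- e].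
  by move=> _ /mapP[p /es ps ->].
by rewrite mulr_suml big_map; apply: eq_bigr => p _; rewrite mulrA.
Qed.

Lemma gen_right_ideal_gel g : g \in s -> gen_right_ideal (gel A g - 1).
Proof.
move=> gs; exists [:: (g, 1)]; first by move=> p /[!inE] /eqP ->.
by rewrite big_seq1 mulr1.
Qed.

(** Membership of [g - 1] in the right ideal defines a subgroup containing [s], to which the
    hypothesis that [s] generates [G] can be applied. *)
Definition gen_group : {pred G} := [pred g | `[< gen_right_ideal (gel A g - 1) >] ].

Lemma gen_group1 : 1%g \in gen_group.
Proof. by apply/asboolP; rewrite gel1 subrr; exact: gen_right_ideal0. Qed.

Lemma gen_groupM : mulg_closed gen_group.
Proof.
move=> g h /asboolP gI /asboolP hI; apply/asboolP.
have -> : gel A (g * h)%g - 1 = (gel A g - 1) * gel A h + (gel A h - 1).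
  by rewrite gelM mulrBl mul1r subrKA.
by apply: gen_right_idealD => //; exact: gen_right_idealM.
Qed.

Lemma gen_groupV : invg_closed gen_group.
Proof.
move=> g /asboolP gI; apply/asboolP.
have -> : gel A g^-1%g - 1 = (gel A g - 1) * - gel A g^-1%g.
  by rewrite mulrN mulrBl mul1r -gelM mulgV gel1 opprB.
exact: gen_right_idealM.
Qed.

HB.instance Definition _ := isMulClosed.Build G gen_group gen_groupM.
HB.instance Definition _ := isMul1Closed.Build G gen_group gen_group1.
HB.instance Definition _ := isInvClosed.Build G gen_group gen_groupV.

Definition gen_groupClosed : groupClosed G := gen_group.

Hypothesis s_gen : forall S : groupClosed G, {subset s <= S} -> forall g, g \in S.

Lemma aug_ideal_gen z : aug_ideal z -> gen_right_ideal z.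
Proof.
move=> zI; rewrite [z]aug_decomposition zI scale0r add0r.
elim: (msupp z : seq G) => [|g r IH]; first by rewrite big_nil; exact: gen_right_ideal0.
rewrite big_cons; apply: gen_right_idealD IH.
have /asboolP gI : g \in gen_group.
  apply: (s_gen (S := gen_groupClosed)) => h hs.
  by apply/asboolP; exact: gen_right_ideal_gel.
have -> : z@_g *: (gel A g - 1) = (gel A g - 1) * (z@_g *: (1 : AG) : AG) :> AG.
  have := gr_mull_linear (gel A g - 1) (z@_g) 1 0.
  by rewrite !addr0 mulr0 mulr1 addr0 => ->.
exact: gen_right_idealM.
Qed.

End RightIdeal.

(** Induction on [n]: up to a scalar, every element lies in the right ideal generated by the [g - 1]
    with [g] in [s]. If [b] spans modulo [I^n], then [1] and the products [(g - 1) m] with [m] in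
    [b] span modulo [I^(n+1)]. *)
Lemma aug_quot_fin_gen n : fin_gen G -> exists b : seq AG, forall z,
  exists2 e : seq (A * AG), (forall p, p \in e -> p.2 \in b)
    & aug_pow n (z - \sum_(p <- e) p.1 *: p.2).
Proof.
move=> [s s_gen]; elim: n => [|n [b bP]]; first by exists [::] => z; exists [::].
pose b' : seq AG := 1 :: [seq (gel A g - 1) * m | g <- s, m <- b].
exists b' => z.
have zI : aug_ideal (z - (augmentation z *: (1 : AG) : AG)).
  rewrite /aug_ideal (linformB (@augmentation_linear A G)).
  by rewrite (linformZ (@augmentation_linear A G)) -gel1 augmentation_gel mulr1 subrr.
suff H : forall y, gen_right_ideal s y -> exists2 e : seq (A * AG),
    (forall p, p \in e -> p.2 \in b') & aug_pow n.+1 (y - \sum_(p <- e) p.1 *: p.2).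
  have [e eb eP] := H _ (aug_ideal_gen s_gen zI).
  exists ((augmentation z, 1 : AG) :: e); last by rewrite big_cons opprD addrA.
  by move=> p /[!inE] /predU1P[->|/eb]; rewrite ?inE ?eqxx.
move=> _ [e es ->]; elim: e es => [|[g x] e IH] es.
  by exists [::] => //; rewrite !big_nil subrr; exact: aug_pow0.
have [|c cb cP] := IH; first by move=> p pe; apply: es; rewrite inE pe orbT.
have [d db dP] := bP x.
exists ([seq (q.1, (gel A g - 1) * q.2) | q <- d] ++ c).
  move=> p; rewrite mem_cat => /orP[/mapP[q qd ->]|/cb //]; rewrite inE; apply/orP; right.
  by apply: allpairs_f; [exact: (es _ (mem_head _ _)) | exact: db].
rewrite big_cat big_cons big_map opprD addrACA; apply: aug_powD => //.
have -> : \sum_(q <- d) q.1 *: ((gel A g - 1) * q.2)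
    = (gel A g - 1) * \sum_(q <- d) q.1 *: q.2.
  rewrite mulr_sumr; apply: eq_bigr => q _.
  have := gr_mull_linear (gel A g - 1) q.1 q.2 0.
  by rewrite !addr0 mulr0 addr0 => ->.
by rewrite -mulrBr; apply: aug_powMI => //; exact: aug_ideal_gel.
Qed.

Lemma aug_quot_comb n : fin_gen G -> exists b : seq AG, forall z,
  exists c : AG -> A, aug_pow n (z - \sum_(m <- b) c m *: m).
Proof.
move=> /(aug_quot_fin_gen n)[b bP]; exists (undup b) => z; have [e eb eP] := bP z.
exists (fun m => \sum_(p <- e | p.2 == m) p.1).
suff -> : \sum_(m <- undup b) (\sum_(p <- e | p.2 == m) p.1) *: m
  = \sum_(p <- e) p.1 *: p.2 by [].
under eq_bigr do rewrite scaler_suml big_mkcond.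
rewrite exchange_big big_seq [RHS]big_seq; apply: eq_bigr => p /eb pb.
rewrite (bigD1_seq p.2) /= ?undup_uniq ?mem_undup // eqxx big1 ?addr0 // => m mp.
by rewrite eq_sym (negPf mp).
Qed.

End FinitelyGenerated.

(** For [a = g - 1] and [b = h - 1] the element [a + b + a * b] is [gh - 1], and this becomes the
    cocycle identity for products of such factors. *)
Lemma mulr_cocycle (R : pzRingType) (a b y z : R) :
  y * ((a + b + a * b) * z) = y * (a * z) + y * (b * z) + y * (a * (b * z)).
Proof. by rewrite !mulrDl !mulrDr !mulrA. Qed.

(** * Realizing linear forms by cocycles *)

Section Realization.
Variables (A : idomainType) (G : groupType).
Local Notation C := (cochain A G).
Local Notation Bar := (Bar A G).
Local Notation bword := (word C).
Local Notation AG := (group_ring A G).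
Local Notation aug_pow := (ideal_pow (@aug_ideal A G)).
Implicit Types (z : AG) (u v : seq G).

Lemma bev0_tcons g u (l : letter C) (x : Bar) :
  bev0 (g :: u) (tcons l x) = ev_simplex [:: g] l * bev0 u x.
Proof. exact/tev_tcons/ev_simplex_linear. Qed.

(** Expanding [g - 1] as the sum of the [c g m *: m] modulo [I^N] writes [phi((g - 1) z)] as the sum
    of the [c g m * phi(m z)]: the coordinates are cochains in [g], and each [phi(m z)] is again a
    form in [z] killing [I^N], to which induction on [n] applies. *)
Lemma form_tensor (N n : nat) : fin_gen G -> forall phi : AG -> A,
  linear (phi : AG -> A^o) -> (forall z, aug_pow N z -> phi z = 0) ->
  exists2 x : Bar, x \in tspan (fun w : bword => cochain_word 1 w && (size w == n))
    & forall u, size u = n -> bev0 u x = phi (aug_prod A u).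
Proof.
move=> /(aug_quot_comb A N)[b bP].
(* The coordinates are chosen to vanish at [g = 1], which makes them normalized cochains. *)
have /choice[c cP] g : exists c : AG -> A,
    aug_pow N (gel A g - 1 - \sum_(m <- b) c m *: m) /\ (g = 1%g -> forall m, c m = 0).
  have [->|g1] := pselect (g = 1%g).
    exists (fun=> 0); split=> //; rewrite gel1 subrr sub0r.
    rewrite big1 ?oppr0; first exact: aug_pow0.
    by move=> m _; rewrite scale0r.
  by have [c cP] := bP (gel A g - 1); exists c.
have red (m : AG) : (fun s : simplex G 1 => c (s ord0) m : A^o) \in @reduced A G 1.
  apply/asboolP; split; last exact: (cP _).2.
  by move=> s [i]; rewrite (ord1 i) => /(cP _).2.
elim: n => [|n IH] phi phiL phiN.
  exists (phi 1 *: bar_word ([::] : bword)).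
    by apply: rpredZ; exact: tpure_span.
  move=> [|//] _; rewrite (linformZ (bev0_linear _)) /bev0 bev_word mulr1.
  by rewrite aug_prod_nil.
have /choice[x xP] (m : AG) : exists x : Bar,
    x \in tspan (fun w : bword => cochain_word 1 w && (size w == n))
    /\ forall u, size u = n -> bev0 u x = phi (m * aug_prod A u).
  have [||x x1 x2] := IH (fun z => phi (m * z)); last by exists x.
    by move=> a y z; rewrite gr_mull_linear phiL.
  by move=> z zN; apply: phiN; exact: aug_pow_mull.
exists (\sum_(m <- b) tcons (mkletter (MkCochain (red m))) (x m)).
  apply: rpred_sum => m _.
  apply: (tspan_lift (tcons_multilinear _)) (xP m).1 => w w1.
  by apply: tpure_span; rewrite /= eqSS.
move=> [//|g u] [un]; rewrite (linform_sum (bev0_linear _)) aug_prod_cons.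
transitivity (phi ((\sum_(m <- b) c g m *: m) * aug_prod A u)).
  rewrite mulr_suml (linform_sum phiL); apply: eq_bigr => m _.
  by rewrite bev0_tcons ev_simplex1 (xP m).2 // gr_scalerAl (linformZ phiL).
apply/eqP; rewrite eq_sym -subr_eq0 -(linformB phiL) -mulrBl phiN //.
exact/aug_pow_mulr/(cP g).1.
Qed.

Hypothesis A_PID : is_PID A.

(** The components of weight at most [n] are summed; beyond them [phi] vanishes on products. The sum
    is a cocycle because its values are those of a linear form on products in the ring. *)
Lemma form_H0_Bar (n : nat) : fin_gen G -> forall phi : AG -> A,
  linear (phi : AG -> A^o) -> (forall z, aug_pow n.+1 z -> phi z = 0) ->
  exists2 x : Bar, x \in @H0_Bar_le A G n & bar_form x =1 phi.
Proof.
move=> Gfg phi phiL phiN.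
have /choice[x xP] p : exists x : Bar,
    x \in tspan (fun w : bword => cochain_word 1 w && (size w == p))
    /\ forall u, size u = p -> bev0 u x = phi (aug_prod A u).
  by have [x x1 x2] := form_tensor p Gfg phiL phiN; exists x.
pose X := \sum_(p < n.+1) x p.
have XE u : bev0 u X = phi (aug_prod A u).
  rewrite (linform_sum (bev0_linear u)).
  have x0 p : p != size u -> bev0 u (x p) = 0.
    move=> pu; apply: (tev_size_span (@ev_simplex_linear A G) (xP p).1) => w.
    by case/andP=> _ /eqP ->; rewrite size_map.
  have [un|nu] := ltnP (size u) n.+1.
    rewrite (bigD1 (Ordinal un)) //= (xP _).2 // big1 ?addr0 // => p.
    by rewrite -val_eqE => /= pu; exact: x0.
  rewrite big1 => [|p _]; last by apply: x0; rewrite ltn_eqF // (leq_trans (ltn_ord p)).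
  by rewrite phiN //; apply: aug_pow_le nu (aug_prod_pow A u).
have X0 : X \in @bar_deg A G 0.
  apply: rpred_sum => p _; have /asboolP[y yP ->] := (xP p).1.
  apply/asboolP; exists y => // w /yP /andP[w1 _].
  rewrite unfold_in /word_deg big_seq big1 // => l lw.
  by rewrite (eqP (allP w1 l lw)) subrr.
have Xn : X \in @bar_wt A G n.
  apply: rpred_sum => p _; have /asboolP[y yP ->] := (xP p).1.
  apply/asboolP; exists y => // w /yP /andP[_ /eqP wp].
  by rewrite unfold_in wp lez_nat -ltnS.
exists X.
  apply/andP; split=> //; apply/andP; split=> //; apply/eqP.
  apply: (cocycle_bar_d A_PID X0) => u g h v; rewrite !XE -!(linformD phiL).
  congr phi; rewrite /aug_prod !big_cat /= !big_cons.
  rewrite -mulr_cocycle; congr (_ * (_ * _)).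
  by rewrite mulrBr mulr1 [RHS]addrC [RHS]addrA subrK mulrBl mul1r -gelM subrKA.
move=> z; move: z; apply: (gr_linear_ext (M := A^o)) => //; first exact: bar_form_linear.
by move=> g; rewrite bar_form_gel !XE aug_prod1 aug_prod_nil -(linformD phiL) subrK.
Qed.

End Realization.

(** * The Johnson homomorphism *)

Section JohnsonHomomorphism.
Variables (A : idomainType) (G : groupType).
Local Notation C := (cochain A G).
Local Notation Bar := (Bar A G).
Local Notation AG := (group_ring A G).
Local Notation aug_pow := (ideal_pow (@aug_ideal A G)).
Implicit Types (x y : Bar) (f g : group_aut G) (u v : seq G).

Lemma pull_bar_mul f g x : pull_bar (f * g)%g x = pull_bar g (pull_bar f x).
Proof.
move: x; apply: tensor_ext => [||w]; first exact: pull_bar_linear.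
  by move=> a x y; rewrite !pull_bar_linear.
rewrite -/(bar_word w) !pull_barE -map_comp; congr bar_word; apply: eq_map => l /=.
by congr mkletter; exact: cochain_ext.
Qed.

Lemma pull_bar1 x : pull_bar 1%g x = x.
Proof.
move: x; apply: (tensor_ext (g := id)) => [|//|w]; first exact: pull_bar_linear.
rewrite -/(bar_word w) pull_barE; congr bar_word; rewrite -[RHS]map_id.
by apply: eq_map => -[n c]; congr mkletter; exact: cochain_ext.
Qed.

Lemma pull_bar_H1 f (h : H1 A G) : pull_bar f (bar_H1 h) = bar_H1 (pull_H1 f h).
Proof. by rewrite pull_barE; congr bar_word; congr [:: mkletter _]; exact: cochain_ext. Qed.

Lemma hev_pull f u t : hev u (pull_talg f t) = hev (map f u) t :> A.
Proof.
move: t; apply: (tensor_ext (M := A^o)).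
- by move=> a t s; rewrite pull_talg_linear hev_linear.
- exact: hev_linear.
move=> w; rewrite /pull_talg tmap_pure; last by move=> _; exact: pull_H1_linear.
rewrite /hev !(tev_pure (@ev_H1_linear A G)).
by elim: u w => [|g u IH] [|l w] //=; rewrite IH.
Qed.

Lemma is_lead_linear n a x y t s :
  is_lead n x t -> is_lead n y s -> is_lead n (a *: x + y) (a *: t + s).
Proof.
move=> [t1 t2] [s1 s2]; split; first by apply: rpredD => //; exact: rpredZ.
rewrite tmap_linear; last by move=> _; exact: bar_H1_linear.
by rewrite t2 s2 redcoprod_iter_linear.
Qed.

Lemma bar_H1_wt n (h : H1 A G) : (0 < n)%N -> bar_H1 h \in @bar_wt A G n.
Proof. by move=> n0; apply: tpure_span; rewrite /= lez_nat. Qed.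

Lemma johnsonS n f : f \in johnson A n.+1 -> f \in johnson A n.
Proof. by move=> /asboolP fJ; apply/asboolP => x; apply: aug_powS. Qed.

Lemma field_torsion_free n : (forall a : A, a != 0 -> a \is a GRing.unit) ->
  @quot_torsion_free A AG (aug_pow n).
Proof.
move=> A_field a z /A_field aU zn.
by rewrite -[z]scale1r -(mulVr aU) -scalerA; exact: aug_powZ.
Qed.

Hypothesis A_PID : is_PID A.

Lemma bar_H1_H0_le n (h : H1 A G) : (0 < n)%N -> bar_H1 h \in @H0_Bar_le A G n.
Proof.
move=> n0; apply/andP; split; last exact: bar_H1_wt.
apply/andP; split; first exact: bar_H1_deg.
apply/eqP/(cocycle_bar_d A_PID (bar_H1_deg h)) => u g g' v; rewrite !bev0_H1.
have /asboolP hM := hval_hom h.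
by case: u v => [|a [|b u]] [|c v] /=; rewrite ?addr0.
Qed.

Lemma is_lead_pull n f x t : (0 < n)%N -> x \in @H0_Bar_le A G n ->
  t \in @massey_vanish A G n -> is_lead n x t -> is_lead n (pull_bar f x) (pull_talg f t).
Proof.
move=> n0 xn tn xt; have /andP[/andP[x0 _] xwt] := xn.
have /andP[tpow _] := pull_massey_vanish f tn.
apply: bev0_is_lead => //; [exact: pull_bar_deg|exact: pull_bar_wt|].
by move=> u un; rewrite bev0_pull hev_pull (is_lead_bev0 n0 xwt xt) ?size_map.
Qed.

Lemma H0_lead0 n x : x \in @H0_Bar_le A G n.+1 -> is_lead n.+1 x 0 ->
  x \in @H0_Bar_le A G n.
Proof.
move=> /andP[xH xwt] xl; apply/andP; split=> //; have /andP[x0 _] := xH.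
have := sub_symbol_wt A_PID (ltn0Sn n) x0 xwt xl.1 (fun u => is_lead_bev0 (ltn0Sn n) xwt xl).
by rewrite (linear_0E (@symbol_linear A G)) subr0 -predn_int.
Qed.

Section Displacement.
Variable k : nat.
Hypothesis k_gt0 : (0 < k)%N.

(** The difference of two lifts has leading term zero, hence weight at most [k], and is fixed by
    [f]. *)
Lemma displacement_lead f x y t : f \in johnson A k ->
  x \in @H0_Bar_le A G k.+1 -> y \in @H0_Bar_le A G k.+1 ->
  is_lead k.+1 x t -> is_lead k.+1 y t -> x - pull_bar f x = y - pull_bar f y.
Proof.
move=> fJ xn yn xt yt.
have := is_lead_linear (-1) xt yt; rewrite !scaleN1r addNr => d_lead.
have := H0_le_linear (-1) xn yn; rewrite scaleN1r => /H0_lead0 /(_ d_lead).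
move=> /(johnson_fixes A_PID fJ); rewrite linearD linearN /= => E.
rewrite -[x - _](addrK (pull_bar f y)); congr (_ - _).
by rewrite -addrA E addrA subrr add0r.
Qed.

Lemma johnson_hom_exists f : f \in johnson A k ->
  exists tau : {linear massey_kernel A G k.+1 -> H1 A G}, is_johnson_hom f tau.
Proof.
move=> fJ.
have /choice[x xP] (t : massey_kernel A G k.+1) : exists x : Bar,
    x \in @H0_Bar_le A G k.+1 /\ is_lead k.+1 x t.
  by have [x x1 x2] := massey_lift A_PID (ltn0Sn k) (mvalP t); exists x.
have /choice[h hP] t : exists h, bar_H1 h = x t - pull_bar f (x t).
  exact: (johnson_displacement A_PID k_gt0 fJ (xP t).1).
(* The value does not depend on the lift, so a combination of lifts can serve for a combination of
   tensors. *)
have hE y (t : massey_kernel A G k.+1) : y \in @H0_Bar_le A G k.+1 -> is_lead k.+1 y t ->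
    bar_H1 (h t) = y - pull_bar f y.
  by move=> yn yt; rewrite hP; exact: (displacement_lead fJ (xP t).1 yn (xP t).2 yt).
have h_linear : linear h.
  move=> a t s; apply: (@bar_H1_inj A G).
  have yn := H0_le_linear a (xP t).1 (xP s).1.
  rewrite (hE _ (a *: t + s) yn (is_lead_linear a (xP t).2 (xP s).2)).
  by rewrite bar_H1_linear !hP pull_bar_linear opprD addrACA -scalerBr.
pose tau : {linear massey_kernel A G k.+1 -> H1 A G} :=
  HB.pack h (GRing.isLinear.Build _ _ _ _ h h_linear).
exists tau.
by move=> y t /= yn yt; exact: hE.
Qed.

(** Each form killing [I^(k+2)] comes from a cocycle of weight at most [k + 1], which [f] fixes; so
    all these forms vanish at [f z - z], and they separate the points of [A[G]/I^(k+2)]. *)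
Lemma johnson_separates f : fin_gen G -> quot_torsion_free (aug_pow k.+2) ->
  (forall x, x \in @H0_Bar_le A G k.+1 -> pull_bar f x = x) -> f \in johnson A k.+1.
Proof.
move=> Gfg Atf fix_f; apply/asboolP => z.
have [b bP] := aug_quot_comb A k.+2 Gfg.
apply: (separating_forms _ _ Atf bP).
- exact: aug_pow0.
- by move=> a x y; exact: aug_pow_linear.
move=> phi phiL phiN; have [x xn xE] := form_H0_Bar A_PID Gfg phiL phiN.
rewrite (linformB phiL) -!xE -bar_form_pull fix_f //; exact: subrr.
Qed.

End Displacement.

End JohnsonHomomorphism.

Theorem theorem1p14 (A : idomainType) (G : groupType) (k : nat) :
  is_PID A -> (0 < k)%N ->
  (* the leading term is a well-defined surjection onto K_(k+1) *)
  (forall x : Bar A G, x \in H0_Bar_le k.+1 ->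
     exists! t : massey_kernel A G k.+1, is_lead k.+1 x t) /\
  (forall t : massey_kernel A G k.+1,
     exists2 x : Bar A G, x \in H0_Bar_le k.+1 & is_lead k.+1 x t) /\
  exists tau : group_aut G -> {linear massey_kernel A G k.+1 -> H1 A G},
    [/\ (* for f in J(k), [tau f] is the map determined by x |-> x - f^* x *)
        forall f : group_aut G, f \in johnson A k ->
          forall u : {linear massey_kernel A G k.+1 -> H1 A G},
            is_johnson_hom f u <-> u =1 tau f,
        (* homomorphism *)
        forall f g : group_aut G, f \in johnson A k -> g \in johnson A k ->
          forall t, tau (f * g)%g t = tau f t + tau g t,
        (* equivariance *)
        forall f g : group_aut G, f \in johnson A k ->
          forall t, tau (g * f * g^-1)%g t
                    = pull_H1 (g^-1)%g (tau f (pull_massey g t)),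
        (* kernel *)
        forall f : group_aut G, f \in johnson A k.+1 ->
          f \in johnson A k /\ forall t, tau f t = 0
      & (fin_gen G ->
         quot_torsion_free (ideal_pow (@aug_ideal A G) k.+2) ->
         forall f : group_aut G, f \in johnson A k ->
           (forall t, tau f t = 0) -> f \in johnson A k.+1) /\
        ((forall a : A, a != 0 -> a \is a GRing.unit) ->
         quot_torsion_free (ideal_pow (@aug_ideal A G) k.+2))].
Proof.
move=> A_PID k0.
have lead_ex (x : Bar A G) : x \in H0_Bar_le k.+1 ->
    exists t : massey_kernel A G k.+1, is_lead k.+1 x t.
  by move=> xn; have [t tn xt] := H0_lead A_PID (ltn0Sn k) xn; exists (MkMassey tn).
have lift (t : massey_kernel A G k.+1) :
    exists2 x : Bar A G, x \in H0_Bar_le k.+1 & is_lead k.+1 x t.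
  exact: (massey_lift A_PID (ltn0Sn k) (mvalP t)).
split.
  move=> x xn; have [t xt] := lead_ex x xn; exists t; split=> // s xs; apply: val_inj.
  have /andP[_ xwt] := xn.
  exact: (lead_unique A_PID (ltn0Sn k) xwt xt xs).
split=> //.
(* Outside [johnson A k] the value of [tau] is set to zero. *)
have /choice[tau tauP] f : exists tau : {linear massey_kernel A G k.+1 -> H1 A G},
    f \in johnson A k -> is_johnson_hom f tau.
  have [fJ|fJ] := boolP (f \in johnson A k); last by exists \0.
  by have [tau tauP] := johnson_hom_exists A_PID k0 fJ; exists tau.
(* Elements of [H] have weight one, and [1 <= k]. *)
have H1_fix f (h : H1 A G) : f \in johnson A k -> pull_bar f (bar_H1 h) = bar_H1 h.
  move=> fJ; apply: (johnson_fixes A_PID fJ); exact: bar_H1_H0_le.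
exists tau; split.
- move=> f fJ u; split=> [uP t|uE x t xn xt]; last by rewrite uE; exact: (tauP f fJ).
  have [x xn xt] := lift t; apply: (@bar_H1_inj A G).
  by rewrite (uP x t xn xt) (tauP f fJ x t xn xt).
(* The displacement of [x] under [f * g] is its displacement under [g] plus the pullback by [g] of
   its displacement under [f]; the latter lies in [H] and is fixed by [g]. *)
- move=> f g fJ gJ t; have [x xn xt] := lift t; apply: (@bar_H1_inj A G).
  rewrite (tauP _ (johnsonM fJ gJ) x t xn xt).
  rewrite -[tau f t]scale1r bar_H1_linear scale1r (tauP g gJ x t xn xt).
  rewrite -(H1_fix g (tau f t) gJ) (tauP f fJ x t xn xt) pull_bar_mul linearB /=.
  by rewrite addrC subrKA.
(* The displacement of [x] under [g * f * g^-1] is the pullback by [g^-1] of the displacement under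
   [f] of [pull_bar g x], whose leading term is the pullback of [t]. *)
- move=> f g fJ t; have [x xn xt] := lift t; apply: (@bar_H1_inj A G).
  rewrite (tauP _ (johnson_conj g fJ) x t xn xt) -pull_bar_H1.
  have gxt := is_lead_pull A_PID g (ltn0Sn k) xn (mvalP t) xt.
  rewrite (tauP f fJ (pull_bar g x) (pull_massey g t) (H0_le_pull g xn) gxt).
  rewrite !pull_bar_mul (linearB (pull_bar g^-1%g)); congr (_ - _).
  by rewrite /= -pull_bar_mul mulgV pull_bar1.
- move=> f fJ; split=> [|t]; first exact: johnsonS.
  have [x xn xt] := lift t; apply: (@bar_H1_inj A G).
  (* [johnson_fixes] is applied one level higher: all cocycles of weight at most [k + 1] are
     fixed. *)
  rewrite (tauP f (johnsonS fJ) x t xn xt) (johnson_fixes A_PID fJ xn) subrr.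
  exact/esym/linear_0E/bar_H1_linear.
split; last exact: field_torsion_free.
move=> Gfg Atf f fJ tau0; apply: (johnson_separates A_PID Gfg Atf) => x xn.
have [t xt] := lead_ex x xn; have := tauP f fJ x t xn xt.
rewrite tau0 (linear_0E (@bar_H1_linear A G)) => /esym/eqP.
by rewrite subr_eq0 => /eqP <-.
Qed.
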